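(* Let $X$ be an $L_1$-predual. If $E_X'$ is an infinite set, then $X$ has the weak-DD2P.
   Context: Banach spaces are over $\mathbb{K}=\mathbb{R}$ or $\mathbb{C}$; $B_X$ and $S_X$ denote the closed unit ball and unit sphere of $X$. $X$ is an $L_1$-predual if $X^*$ is isometrically isomorphic to $L_1(\mu)$ for some measure $\mu$. On $S_{X^*}$ consider the equivalence relation $f\sim g$ if and only if $f$ and $g$ are linearly dependent; $S_{X^*}/\!\sim$ carries the quotient topology induced by the weak$^*$ topology and $\pi\colon S_{X^*}\to S_{X^*}/\!\sim$ is the quotient map. $E_X$ denotes the set $\pi(\operatorname{ext}(B_{X^*}))$ (image of the set of extreme points of $B_{X^*}$), regarded as a topological space in its own right with the topology inherited from $S_{X^*}/\!\sim$, and $E_X'$ is the set of cluster (accumulation) points of the topological space $E_X$; in particular $E_X'\subseteq E_X$. $X$ has the weak-DD2P if for every non-empty relatively weakly open subset $W$ of $B_X$ there exists $x\in W$ such that $\sup_{y\in V}\|x-y\|=2$ for every relatively weakly open subset $V$ of $B_X$ with $x\in V$. *)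

(* Defs.v *)
From HB Require Import structures.
From mathcomp Require Import all_boot all_order all_algebra.
From mathcomp Require Import all_classical all_reals all_analysis.
From mathcomp Require Import measurable_realfun complex.

Set Implicit Arguments.
Unset Strict Implicit.
Unset Printing Implicit Defensive.

Import Order.TTheory GRing.Theory Num.Theory.
Import numFieldNormedType.Exports.

Local Open Scope classical_set_scope.
Local Open Scope ring_scope.

(* `scalar_field R c` is the real field R or the complex field R[i].  Norms of
   normed modules over a field take values in this field (in R[i], as numbers
   with zero imaginary part); `rnorm` is the same norm with values in R. *)
Variant scalar_kind := RealScalars | ComplexScalars.

Definition scalar_field (R : realType) (c : scalar_kind) : numFieldType :=
  match c with
  | RealScalars => R : numFieldType
  | ComplexScalars => R[i] : numFieldType
  end.

Definition re (R : realType) (c : scalar_kind) : scalar_field R c -> R :=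
  match c with
  | RealScalars => fun a : R => a
  | ComplexScalars => fun a : R[i] => complex.Re a
  end.

Definition im (R : realType) (c : scalar_kind) : scalar_field R c -> R :=
  match c with
  | RealScalars => fun _ : R => 0
  | ComplexScalars => fun a : R[i] => complex.Im a
  end.

Definition rnorm (R : realType) (c : scalar_kind)
  (V : normedZmodType (scalar_field R c)) (x : V) : R := re `|x|.

Section ScalarTheory.
Context (R : realType) (c : scalar_kind).
Implicit Types a b : scalar_field R c.

Lemma reD a b : re (a + b) = re a + re b.
Proof. by case: c a b => //= -[? ?] [? ?]. Qed.

Lemma imD a b : im (a + b) = im a + im b.
Proof. by case: c a b => [a b|[? ?] [? ?]] //=; rewrite addr0. Qed.

Lemma reM a b : re (a * b) = re a * re b - im a * im b.
Proof. by case: c a b => [a b|[? ?] [? ?]] //=; rewrite mulr0 subr0. Qed.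

Lemma imM a b : im (a * b) = re a * im b + im a * re b.
Proof. by case: c a b => [a b|[? ?] [? ?]] //=; rewrite mulr0 mul0r addr0. Qed.

Lemma re0 : re (0 : scalar_field R c) = 0. Proof. by case: c. Qed.

Lemma im0 : im (0 : scalar_field R c) = 0. Proof. by case: c. Qed.

Lemma re_le a b : a <= b -> re a <= re b.
Proof.
by case: c a b => //= -[? ?] [? ?]; rewrite lecE /= => /andP[].
Qed.

Lemma rnormE a : rnorm (a : (scalar_field R c)^o) = Num.sqrt (re a ^+ 2 + im a ^+ 2).
Proof.
rewrite /rnorm; case: c a => [a|[x y]] //=.
by rewrite expr0n /= addr0 sqrtr_sqr.
Qed.

Lemma rnormZ (V : normedModType (scalar_field R c)) a (v : V) :
  rnorm (a *: v) = rnorm (a : (scalar_field R c)^o) * rnorm v.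
Proof.
rewrite /rnorm normrZ reM [im `|a|](_ : _ = 0) ?mul0r ?subr0 //.
by case: c a {V v} => [a|[x y]].
Qed.

Lemma rnorm_ge0 (V : normedZmodType (scalar_field R c)) (v : V) : 0 <= rnorm v.
Proof. by rewrite -re0; apply: re_le; exact: normr_ge0. Qed.

Lemma ler_rnormD (V : normedZmodType (scalar_field R c)) (v w : V) :
  rnorm (v + w) <= rnorm v + rnorm w.
Proof. by rewrite /rnorm -reD; apply: re_le; exact: ler_normD. Qed.

Lemma rnorm0 (V : normedZmodType (scalar_field R c)) : rnorm (0 : V) = 0.
Proof. by rewrite /rnorm normr0 re0. Qed.

Lemma rnormN (V : normedZmodType (scalar_field R c)) (v : V) : rnorm (- v) = rnorm v.
Proof. by rewrite /rnorm normrN. Qed.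

End ScalarTheory.

Section L1.
Context (R : realType) (c : scalar_kind).
Context (d : measure_display) (T : measurableType d).
Variable mu : {measure set T -> \bar R}.
Local Notation K := (scalar_field R c).
Implicit Types f g : T -> K^o.

Definition measurable_scalar f :=
  measurable_fun setT (@re R c \o f) /\ measurable_fun setT (@im R c \o f).

Definition int_norm f : \bar R := (\int[mu]_t (rnorm (f t))%:E)%E.

Definition L1_integrable : {pred T -> K^o} :=
  mem [set f | measurable_scalar f /\ (int_norm f < +oo)%E].

Lemma measurable_rnorm f : measurable_scalar f ->
  measurable_fun setT (EFin \o (fun t => rnorm (f t))).
Proof.
move=> [mr mi]; apply/measurable_EFinP.
under eq_fun do rewrite rnormE.
apply: (@measurableT_comp _ _ _ _ _ _ (@Num.sqrt R)).
  by apply: continuous_measurable_fun; exact: sqrt_continuous.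
by apply: measurable_funD; apply: measurable_funX.
Qed.

Lemma L1_submod_closed : submod_closed L1_integrable.
Proof.
split=> [|a f g].
  rewrite inE; split; first split.
  - rewrite (_ : _ \o _ = cst 0); first exact: measurable_cst.
    by apply/funext => t /=; rewrite re0.
  - rewrite (_ : _ \o _ = cst 0); first exact: measurable_cst.
    by apply/funext => t /=; rewrite im0.
  - rewrite /int_norm; under eq_integral do rewrite rnorm0.
    by rewrite integral0.
rewrite !inE => -[[fr fi] foo] [[gr gi] goo].
have mafg : measurable_scalar (a *: f + g).
  split.
  - rewrite (_ : _ \o _ = (fun t => re a * re (f t) - im a * im (f t) + re (g t))).
      apply: measurable_funD => //.
      by apply: measurable_funB; apply: measurable_funM.
    by apply/funext => t /=; rewrite reD reM.
  - rewrite (_ : _ \o _ = (fun t => re a * im (f t) + im a * re (f t) + im (g t))).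
      apply: measurable_funD => //.
      by apply: measurable_funD; apply: measurable_funM.
    by apply/funext => t /=; rewrite imD imM.
have mf := measurable_rnorm (conj fr fi).
have mg := measurable_rnorm (conj gr gi).
have rf t : (0 <= (rnorm (f t))%:E)%E by rewrite lee_fin rnorm_ge0.
have rg t : (0 <= (rnorm (g t))%:E)%E by rewrite lee_fin rnorm_ge0.
have ra : 0 <= rnorm (a : K^o) by exact: rnorm_ge0.
have maf : measurable_fun setT
    (fun t => ((rnorm (a : K^o))%:E * (rnorm (f t))%:E)%E).
  exact: measurable_funeM.
split=> //; apply: (@le_lt_trans _ _
  (\int[mu]_t ((rnorm (a : K^o))%:E * (rnorm (f t))%:E + (rnorm (g t))%:E))%E).
  apply: ge0_le_integral => //.
  - by move=> t _; rewrite lee_fin rnorm_ge0.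
  - exact: measurable_rnorm.
  - exact: emeasurable_funD.
  - by move=> t _; rewrite -EFinM -EFinD lee_fin -rnormZ; exact: ler_rnormD.
rewrite ge0_integralD //; last by move=> t _; rewrite mule_ge0.
rewrite ge0_integralZl_EFin //.
rewrite lte_add_pinfty // lte_mul_pinfty // ?ge0_fin_numE ?lte_fin //.
Qed.

HB.instance Definition _ := GRing.isSubmodClosed.Build K (T -> K^o) L1_integrable
  L1_submod_closed.

Record L1fun := MkL1fun {
  L1fun_val :> T -> K^o;
  L1fun_prop : L1fun_val \in L1_integrable }.

HB.instance Definition _ := [isSub for L1fun_val].
HB.instance Definition _ := [Choice of L1fun by <:].
HB.instance Definition _ := [SubChoice_isSubLmodule of L1fun by <:].

Definition L1_null : {pred L1fun} :=
  mem [set f : L1fun | {ae mu, forall t, f t = 0}].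

Lemma L1_null_closed : zmod_closed L1_null.
Proof.
split=> [|f g]; first by rewrite inE; exact: aeW.
rewrite !inE /= => f0 g0; apply: filterS2 f0 g0 => t /= ft gt.
by rewrite -[LHS]/(f t - g t) ft gt subr0.
Qed.

HB.instance Definition _ := GRing.isZmodClosed.Build L1fun L1_null L1_null_closed.

(* Two integrable functions are identified when their difference vanishes
   almost everywhere. *)
Definition L1 : Type := {ideal_quot L1_null}.
HB.instance Definition _ := Choice.on L1.
HB.instance Definition _ := EqQuotient.on L1.
HB.instance Definition _ := GRing.Zmodule.on L1.

Lemma L1_nullZ a (f : L1fun) : f \in L1_null -> a *: f \in L1_null.
Proof.
rewrite !inE /= => f0; apply: filterS f0 => t /= ft.
by rewrite -[LHS]/(a *: f t) ft scaler0.
Qed.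

Local Open Scope quotient_scope.

Lemma L1_pi_eq (f g : L1fun) :
  \pi_L1 f = \pi_L1 g <-> {ae mu, forall t, f t = g t}.
Proof.
have -> : (\pi_L1 f = \pi_L1 g) <-> f - g \in L1_null.
  by rewrite Quotient.idealrBE; split=> [->|/eqP].
rewrite inE /=; split; apply: filterS => t /=.
- by rewrite -[X in X = 0]/(f t - g t) => /eqP; rewrite subr_eq0 => /eqP.
- by rewrite -[X in X = 0]/(f t - g t) => ->; rewrite subrr.
Qed.

Definition L1_scale a (u : L1) : L1 := \pi_L1 (a *: repr u).

Lemma L1_piZ a (f : L1fun) : L1_scale a (\pi_L1 f) = \pi_L1 (a *: f).
Proof.
apply/eqP; rewrite -Quotient.idealrBE -scalerBr L1_nullZ //.
by rewrite Quotient.idealrBE reprK.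
Qed.

Lemma L1_piD (f g : L1fun) : \pi_L1 (f + g) = \pi_L1 f + \pi_L1 g.
Proof. exact: (raddfD \pi_L1). Qed.

Lemma L1_piP (u : L1) : exists f : L1fun, u = \pi_L1 f.
Proof. by exists (repr u); rewrite reprK. Qed.

Lemma L1_scaleA a b (u : L1) : L1_scale a (L1_scale b u) = L1_scale (a * b) u.
Proof. by have [f ->] := L1_piP u; rewrite !L1_piZ scalerA. Qed.

Lemma L1_scale1 : left_id 1 L1_scale.
Proof. by move=> u; have [f ->] := L1_piP u; rewrite !L1_piZ scale1r. Qed.

Lemma L1_scaleDr : right_distributive L1_scale +%R.
Proof.
move=> a u v; have [f ->] := L1_piP u; have [g ->] := L1_piP v.
by rewrite -L1_piD !L1_piZ scalerDr L1_piD.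
Qed.

Lemma L1_scaleDl (u : L1) : {morph L1_scale^~ u : a b / a + b}.
Proof. by move=> a b; have [f ->] := L1_piP u; rewrite /= !L1_piZ scalerDl L1_piD. Qed.

HB.instance Definition _ := GRing.Zmodule_isLmodule.Build K L1
  L1_scaleA L1_scale1 L1_scaleDr L1_scaleDl.

Definition L1_norm (u : L1) : R := fine (int_norm (repr u)).

Lemma L1_norm_pi (f : L1fun) : L1_norm (\pi_L1 f) = fine (int_norm f).
Proof.
have /L1_pi_eq fg : \pi_L1 (repr (\pi_L1 f)) = \pi_L1 f by rewrite reprK.
have rf (h : L1fun) t : (0 <= (rnorm (h t))%:E)%E by rewrite lee_fin rnorm_ge0.
have mf (h : L1fun) : measurable_fun setT (EFin \o (fun t => rnorm (h t))).
  by have := L1fun_prop h; rewrite inE => -[hm _]; exact: measurable_rnorm.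
congr fine; apply: ge0_ae_eq_integral => //.
- exact: mf.
- exact: mf.
- by apply: filterS fg => t /= ->.
Qed.
End L1.

Section Duality.
Context (R : realType) (c : scalar_kind).
Variable X : completeNormedModType (scalar_field R c).
Local Notation K := (scalar_field R c).

Definition unit_ball : set X := [set x | rnorm x <= 1].

Definition dual : set (X -> K^o) := [set f | linear f /\ continuous f].

(* `sup` is 0 on unbounded sets of reals, so dual_norm is the operator norm
   only for continuous linear f. *)
Definition dual_norm (f : X -> K^o) : R := sup [set rnorm (f x) | x in unit_ball].

Definition dual_ball : set (X -> K^o) := dual `&` [set f | dual_norm f <= 1].

(* The weak* topology is the restriction to the dual of the topology of
   pointwise convergence on functions X -> K. *)
Definition dual_sphere : set {ptws X -> K^o} :=
  dual `&` [set f | dual_norm f = 1].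

Definition weak : topologicalType :=
  initial_topology (fun x : X => (fun f : dual => set_val f x) : {ptws dual -> K^o}).

Definition rel_weakly_open (W : set X) : Prop :=
  exists2 U : set weak, open U & W = unit_ball `&` U.

Definition weak_DD2P : Prop := forall W : set X,
  rel_weakly_open W -> W !=set0 ->
  exists2 x, W x & forall V : set X, rel_weakly_open V -> V x ->
    sup [set rnorm (x - y) | y in V] = 2.

Definition L1_predual : Prop :=
  exists (d : measure_display) (T : measurableType d)
    (mu : {measure set T -> \bar R}) (phi : {linear L1 c mu -> (X -> K^o)}),
    (forall u, dual_norm (phi u) = L1_norm u) /\ range phi = dual.

(* When K is complex, 0 < t < 1 forces t to be real. *)
Definition extreme_points (A : set (X -> K^o)) : set (X -> K^o) :=
  A `&` [set f | forall g h (t : K), A g -> A h -> 0 < t < 1 ->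
    f = t *: g + (1 - t) *: h -> g = f /\ h = f].

Definition lin_dep (f g : X -> K^o) : Prop :=
  exists a b : K, (a, b) <> (0, 0) /\ a *: f + b *: g = 0.

Lemma dual_sphere_neq0 (f : dual_sphere) : set_val f <> 0 :> (X -> K^o).
Proof.
move=> f0; have : dual_norm (set_val f) = 1 by case: (set_valP f).
move: (set_val f) f0 => _ -> /eqP.
rewrite /dual_norm (_ : [set _ | _ in _] = [set 0]) ?sup1 1?eq_sym ?oner_eq0 //.
apply/seteqP; split=> [_ [x _ <-]|_ ->] /=; first by rewrite rnorm0.
by exists 0; rewrite /unit_ball /= rnorm0.
Qed.

Lemma lin_depP (f g : X -> K^o) : f <> 0 -> g <> 0 -> lin_dep f g ->
  exists a b : K, [/\ a != 0, b != 0 & a *: f + b *: g = 0].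
Proof.
have aux (h : X -> K^o) (a : K) : h <> 0 -> a *: h = 0 -> a = 0.
  by move=> h0 /eqP; rewrite scaler_eq0 => /orP[/eqP //|/eqP].
move=> f0 g0 [a [b [ab0 fg]]]; exists a, b; split => //; apply/eqP => e; apply: ab0.
- by move: fg; rewrite e scale0r add0r => /(aux _ _ g0) ->.
- by move: fg; rewrite e scale0r addr0 => /(aux _ _ f0) ->.
Qed.

Definition sphere_rel (f g : dual_sphere) : bool :=
  `[< lin_dep (set_val f) (set_val g) >].

Lemma sphere_rel_refl : reflexive sphere_rel.
Proof.
move=> f; apply/asboolP; exists 1, (-1); split.
  by move=> [/eqP]; rewrite oner_eq0.
by rewrite scaleN1r scale1r subrr.
Qed.

Lemma sphere_rel_sym : symmetric sphere_rel.
Proof.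
have aux f g : sphere_rel f g -> sphere_rel g f.
  move=> /asboolP[a [b [ab0 fg]]]; apply/asboolP; exists b, a.
  by split; [move=> [b0 a0]; apply: ab0; rewrite a0 b0|rewrite addrC].
by move=> f g; apply/idP/idP; exact: aux.
Qed.

Lemma sphere_rel_trans : transitive sphere_rel.
Proof.
move=> g f h /asboolP/(lin_depP (@dual_sphere_neq0 _) (@dual_sphere_neq0 _)).
move=> [a [b [a0 b0 /eqP fg]]].
move=> /asboolP/(lin_depP (@dual_sphere_neq0 _) (@dual_sphere_neq0 _)).
move=> [a' [b' [a'0 b'0 /eqP gh]]]; apply/asboolP; exists (a' * a), (- (b * b')).
split; first by move=> [/eqP]; rewrite mulf_eq0 (negPf a0) (negPf a'0).
move: fg gh; rewrite addr_eq0 => /eqP fg; rewrite addr_eq0 => /eqP gh.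
rewrite -scalerA fg scalerN scalerA mulrC -scalerA gh.
by rewrite scalerN opprK scalerA scaleNr subrr.
Qed.

Canonical sphere_equiv :=
  EquivRel sphere_rel sphere_rel_refl sphere_rel_sym sphere_rel_trans.

(* The quotient of the dual sphere, with the quotient of the weak* topology. *)
Definition sphere_quot : topologicalType :=
  quotient_topology {eq_quot sphere_equiv}%qT.

Definition sphere_proj (f : dual_sphere) : sphere_quot :=
  (\pi_({eq_quot sphere_equiv}) f)%qT.

Definition EX : set sphere_quot :=
  sphere_proj @` [set f : dual_sphere | extreme_points dual_ball (set_val f)].

(* EX carries the topology of `set_type EX`, i.e. the one induced by
   sphere_quot. *)
Definition EX' : set EX := limit_point [set: EX].

End Duality.

Arguments unit_ball {R c} X _.
Arguments dual {R c} X _.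
Arguments dual_ball {R c} X _.
Arguments dual_sphere {R c} X _.
Arguments sphere_proj {R c} X _.
Arguments EX {R c} X _.
Arguments EX' {R c} X _.

(* Main.v *)
Require Import Defs.
From HB Require Import structures.
From mathcomp Require Import all_boot all_order all_algebra.
From mathcomp Require Import all_classical all_reals all_analysis.
From mathcomp Require Import measurable_realfun complex ring lra.
Import Order.TTheory GRing.Theory Num.Theory.
Import numFieldNormedType.Exports.

(** An extreme point e of the unit ball of the dual, seen in L1(mu), is carried by an
    atom: for a real function w bounded by 1/2 with zero mean against |e|, both
    e (1 + w) and e (1 - w) have norm 1, so that w e = 0 by extremality, and hence
    every measurable function is constant on the support of e. Therefore K e is an
    L-summand of the dual: there is a linear coefficient a with a e = 1 and
    |f| = |a f| + |f - a f e| for every f ([L1_predual_extreme_L_atom]).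

    Two things can be done with such an e. First, given x in the ball and a scalar s
    with |s| <= 1, the functional f |-> a f * s + (f x - a f * e x) is in the ball of
    the bidual, and Goldstine's theorem turns it into a point y of the ball with e y
    close to s and f y close to f x for finitely many f whose coefficient a f is
    small ([L_atom_patch]). Secondly, if e x is close to 1, then x can be moved by a
    small amount in norm to a point of the ball where e is exactly 1
    ([L_atom_attain]): Hahn-Banach duality together with the L-summand property gives
    a point with a much smaller defect, and iterating converges.

    Extreme points in different directions have independent coefficients, whose
    moduli at f add up to at most |f|; so, for every m > 0, only finitely many
    directions have a coefficient at f of modulus at least m ([finite_heavy]).

    Now let W be relatively weakly open, described around one of its points by
    finitely many functionals. As EX' is infinite, it has a direction that is light
    for all of them, and the two operations above give x in W and an extreme point e
    in this direction with e x = 1 ([exists_peak]). Given a relatively weakly open V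
    around x, the direction of e is a cluster point and the quotient of the dual
    sphere is a T1 space; so there is an extreme point e' with |e' x| close to 1 whose
    direction is light for the functionals describing V
    ([exists_light_direction]). Prescribing the value opposite to e' x at e' gives y
    in V with |x - y| close to 2 ([diametral_peak]). *)

Set Implicit Arguments.
Unset Strict Implicit.
Unset Printing Implicit Defensive.
Local Open Scope classical_set_scope.
Local Open Scope ring_scope.

(** * Scalars and their real parts *)

Section Scalars.
Context (R : realType) (c : scalar_kind).
Local Notation K := (scalar_field R c).
Implicit Types (a b : K) (r s : R).

Definition of_real : R -> K :=
  match c as c0 return R -> scalar_field R c0 with
  | RealScalars => id
  | ComplexScalars => fun r => r%:C%C
  end.

Definition scalar_conj : K -> K :=
  match c as c0 return scalar_field R c0 -> scalar_field R c0 with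
  | RealScalars => id
  | ComplexScalars => fun z => (z^*)%C
  end.

Lemma scalar_eq a b : re a = re b -> im a = im b -> a = b.
Proof.
by rewrite /re /im; case: c a b => [a b //|[x y] [z t]] /= -> ->.
Qed.

Lemma re_of_real r : re (of_real r) = r. Proof. by rewrite /of_real; case: c. Qed.
Lemma im_of_real r : im (of_real r) = 0. Proof. by rewrite /of_real; case: c. Qed.
Lemma re_conj a : re (scalar_conj a) = re a. Proof. by rewrite /scalar_conj; case: c a => // -[]. Qed.
Lemma im_conj a : im (scalar_conj a) = - im a.
Proof. by rewrite /scalar_conj; case: c a => [a|[]] //=; rewrite oppr0. Qed.
Lemma re1 : re (1 : K) = 1. Proof. by case: c. Qed.
Lemma im1 : im (1 : K) = 0. Proof. by case: c. Qed.
Lemma reN a : re (- a) = - re a. Proof. by case: c a => // -[]. Qed.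
Lemma imN a : im (- a) = - im a.
Proof. by case: c a => [a|[]] //=; rewrite oppr0. Qed.
Lemma reB a b : re (a - b) = re a - re b. Proof. by rewrite reD reN. Qed.
Lemma imB a b : im (a - b) = im a - im b. Proof. by rewrite imD imN. Qed.

Definition re_imE := (re_of_real, im_of_real, re_conj, im_conj, re1, im1, reB, imB,
  reN, imN, reD, imD, reM, imM, re0, im0).

Lemma of_realD r s : of_real (r + s) = of_real r + of_real s.
Proof. by apply: scalar_eq; rewrite !re_imE; ring. Qed.
Lemma of_realB r s : of_real (r - s) = of_real r - of_real s.
Proof. by apply: scalar_eq; rewrite !re_imE; ring. Qed.
Lemma of_realN r : of_real (- r) = - of_real r.
Proof. by apply: scalar_eq; rewrite !re_imE ?oppr0. Qed.
Lemma of_realM r s : of_real (r * s) = of_real r * of_real s.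
Proof. by apply: scalar_eq; rewrite !re_imE; ring. Qed.
Lemma of_real1 : of_real 1 = 1. Proof. by apply: scalar_eq; rewrite !re_imE. Qed.
Lemma of_real0 : of_real 0 = 0. Proof. by apply: scalar_eq; rewrite !re_imE. Qed.

Lemma of_real_ge0E a : 0 <= a -> a = of_real (re a).
Proof.
rewrite /of_real /re; case: c a => [//|[x y]] /=.
by rewrite lecE /= => /andP[/eqP -> _].
Qed.

Lemma of_real_lt r s : (of_real r < of_real s) = (r < s).
Proof. by rewrite /of_real; case: c => //=; rewrite ltcR. Qed.

Lemma normr_of_real (V : normedZmodType K) (v : V) : `|v| = of_real (rnorm v).
Proof. by rewrite {1}(of_real_ge0E (normr_ge0 v)). Qed.

Lemma abs_sqr a : rnorm (a : K^o) ^+ 2 = re a ^+ 2 + im a ^+ 2.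
Proof. by rewrite rnormE sqr_sqrtr // addr_ge0 ?sqr_ge0. Qed.

Lemma abs_of_real r : rnorm (of_real r : K^o) = `|r|.
Proof. by rewrite rnormE !re_imE expr0n addr0 sqrtr_sqr. Qed.

Lemma abs_conj a : rnorm (scalar_conj a : K^o) = rnorm (a : K^o).
Proof. by rewrite !rnormE !re_imE sqrrN. Qed.

Lemma absM a b : rnorm (a * b : K^o) = rnorm (a : K^o) * rnorm (b : K^o).
Proof. exact: (rnormZ a (b : K^o)). Qed.

Lemma ler_re_abs a : `|re a| <= rnorm (a : K^o).
Proof. by rewrite rnormE -sqrtr_sqr ler_wsqrtr // lerDl sqr_ge0. Qed.

Lemma re_le_abs a : re a <= rnorm (a : K^o).
Proof. exact: le_trans (ler_norm _) (ler_re_abs a). Qed.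

Lemma mul_conj a : scalar_conj a * a = of_real (rnorm (a : K^o) ^+ 2).
Proof. by apply: scalar_eq; rewrite !re_imE ?abs_sqr; ring. Qed.

Lemma rnorm_eq0 (V : normedZmodType K) (v : V) : rnorm v = 0 -> v = 0.
Proof. by move=> v0; apply: normr0_eq0; rewrite normr_of_real v0 of_real0. Qed.

Lemma rnormB (V : normedZmodType K) (v w : V) : rnorm (v - w) = rnorm (w - v).
Proof. by rewrite -rnormN opprB. Qed.

Lemma rnorm_triangle (V : normedZmodType K) (u v w : V) :
  rnorm (u - w) <= rnorm (u - v) + rnorm (v - w).
Proof. by apply: le_trans (ler_rnormD _ _); rewrite addrA subrK. Qed.

Lemma rnormZr (V : normedModType K) r (v : V) :
  rnorm (of_real r *: v) = `|r| * rnorm v.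
Proof. by rewrite rnormZ abs_of_real. Qed.

Lemma exists_phase a : exists2 u : K, rnorm (u : K^o) = 1 &
  u * a = of_real (rnorm (a : K^o)).
Proof.
have [a0|a0] := eqVneq (rnorm (a : K^o)) 0.
  exists 1; first by rewrite -of_real1 abs_of_real normr1.
  by rewrite a0 of_real0 (rnorm_eq0 a0) mulr0.
exists (of_real (rnorm (a : K^o))^-1 * scalar_conj a).
  by rewrite absM abs_of_real abs_conj ger0_norm ?invr_ge0 ?rnorm_ge0 // mulVf.
by rewrite -mulrA mul_conj -of_realM expr2 mulrA mulVf // mul1r.
Qed.

(** Topological statements over K, where radii are scalars, reduce to real
    estimates. *)
Lemma nbhs_rnormP (V : normedModType K) (x : V) (A : set V) :
  nbhs x A <-> exists2 e : R, 0 < e & forall y, rnorm (x - y) < e -> A y.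
Proof.
split=> [/nbhs_normP[e e0 eA]|[e e0 eA]].
- rewrite /= in e0; have eE := of_real_ge0E (ltW e0).
  have re0 : 0 < re e by rewrite -of_real_lt -eE of_real0.
  exists (re e) => // y xy; apply: eA => /=.
  by rewrite normr_of_real eE of_real_lt.
- apply/nbhs_normP; exists (of_real e) => /=.
    by rewrite -of_real0 of_real_lt.
  by move=> y /=; rewrite normr_of_real of_real_lt => /eA.
Qed.

End Scalars.
Arguments of_real {R c} r.
Arguments scalar_conj {R c} a.

(** * The dual norm *)

Section Dual.
Context (R : realType) (c : scalar_kind) (X : completeNormedModType (scalar_field R c)).
Local Notation K := (scalar_field R c).
Implicit Types (f g : X -> K^o) (x y : X).

Lemma linear_funD f x y : linear f -> f (x + y) = f x + f y.
Proof. by move=> lf; rewrite -[x in LHS]scale1r lf scale1r. Qed.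

Lemma linear_fun0 f : linear f -> f 0 = 0.
Proof. by move=> lf; apply: (addrI (f 0)); rewrite -linear_funD // !addr0. Qed.

Lemma linear_funZ f (a : K) x : linear f -> f (a *: x) = a * f x.
Proof. by move=> lf; rewrite -[a *: x]addr0 lf linear_fun0 // addr0. Qed.

Lemma linear_funB f x y : linear f -> f (x - y) = f x - f y.
Proof.
by move=> lf; rewrite linear_funD // -scaleN1r linear_funZ // mulN1r.
Qed.

Lemma dual_bounded f : dual X f -> exists2 M, 0 < M &
  forall x, rnorm (f x) <= M * rnorm x.
Proof.
move=> [lf cf]; have /nbhs_rnormP[e e0 ef] : nbhs 0 (f @^-1` [set a | rnorm a < 1]).
  apply: (cf 0); apply/nbhs_rnormP; rewrite linear_fun0 //.
  by exists 1 => // a; rewrite sub0r rnormN.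
exists (2 / e); first by rewrite divr_gt0.
move=> x; have [x0|x0] := eqVneq (rnorm x) 0.
  by rewrite (rnorm_eq0 x0) linear_fun0 // !rnorm0 mulr0.
have xp : 0 < rnorm x by rewrite lt_neqAle eq_sym x0 rnorm_ge0.
have re0 : 0 <= e / 2 / rnorm x by rewrite !divr_ge0 // ltW.
have /ef /= : rnorm (0 - of_real (e / 2 / rnorm x) *: x) < e.
  by rewrite sub0r rnormN rnormZr ger0_norm // divfK //; lra.
rewrite linear_funZ // absM abs_of_real ger0_norm // => h.
rewrite -(ler_pM2l (_ : 0 < e / 2 / rnorm x)) ?divr_gt0 //.
by apply: le_trans (ltW h) _; rewrite le_eqVlt; apply/orP; left; apply/eqP; field;
  rewrite x0 gt_eqF.
Qed.

Lemma bounded_dual f M : linear f -> (forall x, rnorm (f x) <= M * rnorm x) ->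
  dual X f.
Proof.
move=> lf fM; split=> // x A /nbhs_rnormP[e e0 eA]; apply/nbhs_rnormP.
have M0 : 0 < `|M| + 1 by rewrite ltr_wpDl.
exists (e / (`|M| + 1)); first exact: divr_gt0.
move=> y; rewrite ltr_pdivlMr // => xy; apply: eA; rewrite -linear_funB //.
apply: le_lt_trans (fM _) _; apply: le_lt_trans xy; rewrite mulrC ler_wpM2l ?rnorm_ge0 //.
by apply: le_trans (ler_norm _) _; rewrite lerDl.
Qed.

Lemma unit_ball0 : unit_ball X 0.
Proof. by rewrite /unit_ball /= rnorm0. Qed.

Lemma dual_norm_le f M : (forall x, unit_ball X x -> rnorm (f x) <= M) ->
  dual_norm f <= M.
Proof.
move=> fM; apply: ge_sup; first by exists (rnorm (f 0)), 0 => //; exact: unit_ball0.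
by move=> _ [x /fM ? <-].
Qed.

Lemma dual_norm_ub f x : dual X f -> unit_ball X x -> rnorm (f x) <= dual_norm f.
Proof.
move=> df xB; apply: sup_upper_bound; last by exists x.
split; first by exists (rnorm (f x)), x.
have [M M0 fM] := dual_bounded df; exists M => _ [y yB <-].
by apply: le_trans (fM y) _; rewrite ger_pMr.
Qed.

Lemma dual_norm_ge0 f : dual X f -> 0 <= dual_norm f.
Proof. by move=> df; apply: le_trans (dual_norm_ub df unit_ball0); exact: rnorm_ge0. Qed.

Lemma dual_normP f x : dual X f -> rnorm (f x) <= dual_norm f * rnorm x.
Proof.
move=> df; have [lf _] := df; have [x0|x0] := eqVneq (rnorm x) 0.
  by rewrite (rnorm_eq0 x0) linear_fun0 // !rnorm0 mulr0.
have xp : 0 < rnorm x by rewrite lt_neqAle eq_sym x0 rnorm_ge0.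
have /(dual_norm_ub df) : unit_ball X (of_real (rnorm x)^-1 *: x).
  by rewrite /unit_ball /= rnormZr ger0_norm ?invr_ge0 ?rnorm_ge0 // mulVf.
rewrite linear_funZ // absM abs_of_real ger0_norm ?invr_ge0 ?rnorm_ge0 //.
by rewrite mulrC ler_pdivrMr.
Qed.

(** The unit ball is balanced, so that the real part alone computes the norm. *)
Lemma dual_norm_re_le f M : linear f -> (forall x, unit_ball X x -> re (f x) <= M) ->
  dual_norm f <= M.
Proof.
move=> lf fM; apply: dual_norm_le => x xB; have [u u1 uE] := exists_phase (f x).
have := fM (u *: x); rewrite linear_funZ // uE re_of_real; apply.
by rewrite /unit_ball /= rnormZ u1 mul1r.
Qed.

Lemma dualP f (a : K) g : dual X f -> dual X g -> dual X (a *: f + g).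
Proof.
move=> df dg; have [[lf _] [lg _]] := (df, dg).
have [[M _ fM] [N _ gN]] := (dual_bounded df, dual_bounded dg).
apply: (@bounded_dual _ (rnorm (a : K^o) * M + N)).
  move=> k x y; rewrite !fctE lf lg !scalerDr !scalerA [a * k]mulrC.
  by rewrite addrACA.
move=> x; rewrite !fctE; apply: le_trans (ler_rnormD _ _) _.
by rewrite mulrDl lerD // rnormZ -mulrA ler_wpM2l ?rnorm_ge0.
Qed.

Lemma dual0 : dual X 0.
Proof.
apply: (@bounded_dual _ 0) => [a x y|x]; first by rewrite -[RHS]/(a *: (0 : K^o) + 0) scaler0 addr0.
by rewrite mul0r -[X in rnorm X]/(0 : K^o) rnorm0.
Qed.

Lemma dualZ (a : K) f : dual X f -> dual X (a *: f).
Proof. by move=> df; rewrite -[_ *: _]addr0; apply: dualP => //; exact: dual0. Qed.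

Lemma dualD f g : dual X f -> dual X g -> dual X (f + g).
Proof. by move=> df dg; rewrite -[f]scale1r; exact: dualP. Qed.

Lemma dualB f g : dual X f -> dual X g -> dual X (f - g).
Proof. by move=> df dg; rewrite addrC -scaleN1r; exact: dualP. Qed.

Lemma dual_normZ (a : K) f : dual X f ->
  dual_norm (a *: f) = rnorm (a : K^o) * dual_norm f.
Proof.
move=> df; apply/eqP; rewrite eq_le; apply/andP; split.
  apply: dual_norm_le => x xB; rewrite fctE rnormZ ler_wpM2l ?rnorm_ge0 //.
  exact: dual_norm_ub.
have [a0|a0] := eqVneq (rnorm (a : K^o)) 0.
  by rewrite a0 mul0r; apply/dual_norm_ge0/dualZ.
have ap : 0 < rnorm (a : K^o) by rewrite lt_neqAle eq_sym a0 rnorm_ge0.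
rewrite mulrC -ler_pdivlMr //; apply: dual_norm_le => x xB.
rewrite ler_pdivlMr // mulrC -rnormZ.
exact: (dual_norm_ub (dualZ a df) xB).
Qed.

Lemma dual_norm0 : dual_norm (0 : X -> K^o) = 0.
Proof.
have := dual_normZ 0 dual0.
by rewrite scale0r -of_real0 abs_of_real normr0 mul0r.
Qed.

Lemma dual_norm_eq0 f : dual X f -> dual_norm f = 0 -> f = 0.
Proof.
move=> df f0; apply/funext => x; apply: rnorm_eq0; apply/eqP.
by rewrite eq_le rnorm_ge0 andbT; have := dual_normP x df; rewrite f0 mul0r.
Qed.

Lemma unit_ball_convex (t : R) x y : 0 <= t <= 1 -> unit_ball X x -> unit_ball X y ->
  unit_ball X (of_real t *: x + of_real (1 - t) *: y).
Proof.
move=> /andP[t0 t1]; rewrite /unit_ball /= => xB yB.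
apply: le_trans (ler_rnormD _ _) _; rewrite !rnormZr !ger0_norm ?subr_ge0 //.
nra.
Qed.

End Dual.

(** * Goldstine's theorem *)

Section Goldstine.
Context (R : realType) (c : scalar_kind) (X : completeNormedModType (scalar_field R c)).
Local Notation K := (scalar_field R c).
Implicit Types (f g : X -> K^o) (x y : X) (Phi : (X -> K^o) -> K).

(** An element of the unit ball of the bidual is encoded as a total map on functions
    X -> K, of which only the values on the dual matter. *)
Definition bidual_ball Phi : Prop :=
  (forall (a : K) f g, dual X f -> dual X g -> Phi (a *: f + g) = a * Phi f + Phi g) /\
  (forall f, dual X f -> rnorm (Phi f : K^o) <= dual_norm f).

Lemma bidual0 Phi : bidual_ball Phi -> Phi 0 = 0.
Proof.
move=> [linPhi _]; apply: (addrI (Phi 0)); rewrite addr0.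
by have := linPhi 1 0 0 (@dual0 _ _ X) (@dual0 _ _ X); rewrite scaler0 addr0 mul1r.
Qed.

Lemma dual_comb (l : (X -> K^o) -> K) (fs : seq (X -> K^o)) :
  (forall f, f \in fs -> dual X f) -> dual X (\sum_(f <- fs) l f *: f).
Proof.
elim: fs => [|f fs IH] dfs; first by rewrite big_nil; exact: dual0.
rewrite big_cons; apply: dualP; first by apply: dfs; rewrite mem_head.
by apply: IH => g gfs; apply: dfs; rewrite in_cons gfs orbT.
Qed.

Lemma bidual_comb Phi (l : (X -> K^o) -> K) (fs : seq (X -> K^o)) : bidual_ball Phi ->
  (forall f, f \in fs -> dual X f) ->
  Phi (\sum_(f <- fs) l f *: f) = \sum_(f <- fs) l f * Phi f.
Proof.
move=> BPhi; elim: fs => [|f fs IH] dfs; first by rewrite !big_nil bidual0.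
have dfs' g : g \in fs -> dual X g by move=> gfs; apply: dfs; rewrite in_cons gfs orbT.
rewrite !big_cons BPhi.1 ?IH //; last exact: dual_comb.
by apply: dfs; rewrite mem_head.
Qed.

Lemma re_sum (I : Type) (s : seq I) (F : I -> K) :
  re (\sum_(i <- s) F i) = \sum_(i <- s) re (F i).
Proof. by apply: (big_morph _ (@reD R c) (@re0 R c)). Qed.

(** Let G y be the squared Euclidean distance from the values of y on fs to the
    prescribed ones. If it stays above e ^ 2, a near minimiser x0 of G on the ball
    gives, by first-order optimality along segments, a combination phi of fs whose
    maximum on the ball is almost attained at x0, whereas Phi phi exceeds
    phi x0 by G x0: this is incompatible with |Phi phi| <= |phi|. *)
Lemma goldstine Phi (fs : seq (X -> K^o)) (e : R) : bidual_ball Phi ->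
  (forall f, f \in fs -> dual X f) -> 0 < e ->
  exists2 y, unit_ball X y & forall f, f \in fs -> rnorm (Phi f - f y : K^o) < e.
Proof.
move=> BPhi dfs e0; apply: contrapT => far.
pose G y := \sum_(f <- fs) rnorm (Phi f - f y : K^o) ^+ 2.
have G_ge y : unit_ball X y -> e ^+ 2 <= G y.
  move=> yB; rewrite leNgt; apply/negP => Gy; apply: far; exists y => // f ffs.
  rewrite -(ltr_pXn2r (_ : 0 < 2)%N) ?nnegrE ?rnorm_ge0 ?(ltW e0) //.
  apply: le_lt_trans Gy; rewrite /G (big_rem f) //= lerDl.
  by apply: sumr_ge0 => g _; exact: sqr_ge0.
pose D := \sum_(f <- fs) (2 * dual_norm f) ^+ 2.
have D0 : 0 <= D by apply: sumr_ge0 => f _; exact: sqr_ge0.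
have e2 : 0 < e ^+ 2 by rewrite exprn_gt0.
(* The step t is small enough for the second-order term t * D of the expansion
   of G along a segment to be at most e ^ 2 / 2. *)
pose t := e ^+ 2 / (2 * (D + 1) + e ^+ 2).
have den0 : 0 < 2 * (D + 1) + e ^+ 2 by lra.
have t0 : 0 < t by rewrite divr_gt0.
have t1 : t <= 1 by rewrite ler_pdivrMr // mul1r; lra.
have tD : t * D <= e ^+ 2 / 2.
  rewrite /t mulrAC ler_pdivrMr //; nra.
have hinf : has_inf (G @` unit_ball X).
  split; first by exists (G 0); apply: imageP; exact: unit_ball0.
  by exists (e ^+ 2) => _ [y yB <-]; exact: (G_ge y yB).
have eta0 : 0 < t * e ^+ 2 / 2 by apply: divr_gt0 => //; exact: mulr_gt0.
have [_ [x0 x0B <-] x0min] := inf_adherent eta0 hinf.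
pose l f := scalar_conj (Phi f - f x0).
pose phi := \sum_(f <- fs) l f *: f.
have phiE y : phi y = \sum_(f <- fs) l f * f y.
  rewrite /phi; elim: (fs) => [|f s IH]; rewrite ?big_nil // !big_cons.
  by rewrite -IH.
have dphi : dual X phi by exact: dual_comb.
have phi_le y : unit_ball X y -> re (phi y) <= re (phi x0) + e ^+ 2 / 2.
  move=> yB; pose z := of_real t *: y + of_real (1 - t) *: x0.
  have zB : unit_ball X z by apply: unit_ball_convex => //; rewrite (ltW t0).
  have : inf (G @` unit_ball X) <= G z.
    by apply: ge_inf; [exact: hinf.2|exists z].
  have -> : G z = G x0 - 2 * t * re (phi y - phi x0) +
      t ^+ 2 * \sum_(f <- fs) rnorm (f y - f x0 : K^o) ^+ 2.
    rewrite !phiE reB !re_sum /G -sumrB !mulr_sumr -sumrB -big_split /=.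
    apply: eq_big_seq => f ffs; have [lf _] := dfs f ffs.
    rewrite /z linear_funD // !linear_funZ // /l !abs_sqr !re_imE; ring.
  have : \sum_(f <- fs) rnorm (f y - f x0 : K^o) ^+ 2 <= D.
    rewrite big_seq [D]big_seq; apply: ler_sum => f ffs.
    rewrite ler_pXn2r ?nnegrE ?rnorm_ge0 ?mulr_ge0 ?dual_norm_ge0 //; try exact: dfs.
    apply: le_trans (ler_rnormD _ _) _; rewrite rnormN mulr_natl mulr2n.
    by rewrite lerD // dual_norm_ub //; exact: dfs.
  move: (\sum_(f <- fs) _) => S SD; rewrite reB => infz.
  have SD2 : t ^+ 2 * S <= t * (e ^+ 2 / 2).
    apply: le_trans (_ : t ^+ 2 * D <= _); first by rewrite ler_wpM2l ?sqr_ge0.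
    by rewrite expr2 -mulrA ler_wpM2l // ltW.
  rewrite -lerBlDl -(ler_pM2l t0).
  have -> : t * (e ^+ 2 / 2) = (t * e ^+ 2 / 2) by rewrite mulrA.
  lra.
have : re (Phi phi) <= re (phi x0) + e ^+ 2 / 2.
  apply: le_trans (re_le_abs _) _; apply: le_trans (BPhi.2 _ dphi) _.
  by apply: dual_norm_re_le => //; case: dphi.
have -> : re (Phi phi) = re (phi x0) + G x0.
  rewrite bidual_comb // phiE !re_sum -big_split /=; apply: eq_bigr => f _.
  by rewrite abs_sqr /l !re_imE; ring.
have := G_ge _ x0B; lra.
Qed.

End Goldstine.

(** * Hahn-Banach theorem *)

Section HahnBanach.
Context (R : realType) (V : lmodType R).
Implicit Types (p q : V -> R) (S : V -> set R) (v w : V) (r : R).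

Definition sublinear p : Prop :=
  (forall v w, p (v + w) <= p v + p w) /\ (forall r v, 0 < r -> p (r *: v) = r * p v).

(** These are the convex cones of V * R that project onto V and contain no vertical
    direction pointing down, given by their fibres over V. Their lower envelopes are
    sublinear, which is the source of all sublinear functions below. *)
Definition proper_cone S : Prop :=
  [/\ forall v, S v !=set0,
      forall v w a b, S v a -> S w b -> S (v + w) (a + b),
      forall r v a, 0 < r -> S v a -> S (r *: v) (r * a)
    & forall a, S 0 a -> 0 <= a].

Lemma proper_cone_lbound S v : proper_cone S -> has_lbound (S v).
Proof.
move=> [S0 SD _ Spos]; have [b Sb] := S0 (- v); exists (- b) => a Sa.
by rewrite -subr_ge0 opprK; apply: Spos; rewrite -(subrr v); exact: SD.
Qed.

Lemma proper_cone_inf_le S v a : proper_cone S -> S v a -> inf (S v) <= a.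
Proof. by move=> cS Sa; apply: ge_inf => //; exact: proper_cone_lbound. Qed.

Lemma proper_cone_le_inf S v b : proper_cone S -> (forall a, S v a -> b <= a) ->
  b <= inf (S v).
Proof. by move=> [S0 _ _ _] h; apply: lb_le_inf => // a; exact: h. Qed.

Lemma sublinear_inf S : proper_cone S -> sublinear (fun v => inf (S v)).
Proof.
move=> cS; have [S0 SD SZ Spos] := cS; split=> [v w /=|/=].
  rewrite -lerBlDr; apply: proper_cone_le_inf => // a Sa.
  rewrite lerBlDr -lerBlDl; apply: proper_cone_le_inf => // b Sb.
  by rewrite lerBlDl; apply: proper_cone_inf_le => //; exact: SD.
have le r v : 0 < r -> inf (S (r *: v)) <= r * inf (S v).
  move=> r0; rewrite mulrC -ler_pdivrMr //; apply: proper_cone_le_inf => // a Sa.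
  by rewrite ler_pdivrMr // mulrC; apply: proper_cone_inf_le => //; exact: SZ.
move=> r v r0; apply/eqP; rewrite eq_le le //=.
have := le r^-1 (r *: v); rewrite invr_gt0 scalerA mulVf ?gt_eqF // scale1r => /(_ r0).
by rewrite mulrC ler_pdivlMr // mulrC.
Qed.

Lemma sublinear0 p : sublinear p -> p 0 = 0.
Proof.
move=> [_ pZ]; have := pZ 2 0 (ltr0Sn _ _); rewrite scaler0; lra.
Qed.

(** Zorn's lemma applies because the infimum of a chain of sublinear functions below
    p is the lower envelope of a proper cone. *)
Lemma exists_minimal_sublinear p : sublinear p ->
  exists q, [/\ sublinear q, forall v, q v <= p v &
    forall q', sublinear q' -> (forall v, q' v <= q v) -> forall v, q v <= q' v].
Proof.
move=> subp; pose T := {q | sublinear q /\ forall v, q v <= p v}.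
pose below (s t : T) := `[< forall v, sval t v <= sval s v >].
have [| | | |[q [subq qp]] qmin] := @Zorn T below.
- by move=> s; apply/asboolP => v.
- move=> r s t /asboolP rs /asboolP st; apply/asboolP => v.
  exact: le_trans (st v) (rs v).
- move=> [s hs] [t ht] /asboolP /= st /asboolP /= ts; apply: eq_exist.
  by apply/funext => v; apply/eqP; rewrite eq_le st ts.
- move=> A Atot; have [->|/set0P[s0 As0]] := eqVneq A set0.
    by exists (exist _ p (conj subp (fun v => lexx _))).
  pose S v := [set a | exists2 s, A s & sval s v <= a].
  have cS : proper_cone S.
    split.
    - by move=> v; exists (sval s0 v), s0.
    - move=> v w a b [s As sa] [t At tb].
      have [/asboolP st|/asboolP ts] := Atot s t As At.
      + exists t => //; apply: le_trans ((svalP t).1.1 v w) _.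
        by rewrite lerD // (le_trans (st v)).
      + exists s => //; apply: le_trans ((svalP s).1.1 v w) _.
        by rewrite lerD // (le_trans (ts w)).
    - move=> r v a r0 [s As sa]; exists s => //.
      by rewrite (svalP s).1.2 // ler_pM2l.
    - by move=> a [s As]; rewrite (sublinear0 (svalP s).1).
  have Sp v : inf (S v) <= p v.
    by apply: proper_cone_inf_le => //; exists s0 => //; exact: (svalP s0).2.
  exists (exist _ (fun v => inf (S v)) (conj (sublinear_inf cS) Sp)) => s As.
  by apply/asboolP => v /=; apply: proper_cone_inf_le => //; exists s.
exists q; split=> // q' subq' q'q v.
have q'p w : q' w <= p w by exact: le_trans (q'q w) (qp w).
have /(_ _)/(congr1 sval) /= <- // := qmin (exist _ q' (conj subq' q'p)).
by apply/asboolP.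
Qed.

(** A minimal sublinear function q is additive: for fixed w, lowering q to
    v |-> inf_(t >= 0) (q (v + t *: w) - t * q w) gives a sublinear function
    below q, so that q v <= q (v + w) - q w by minimality. *)
Theorem hahn_banach p : sublinear p ->
  exists2 u : V -> R^o, linear u & forall v, u v <= p v.
Proof.
move=> /exists_minimal_sublinear[q [subq qp qmin]]; exists q => //.
have q0 := sublinear0 subq; have [qD qZ] := subq.
have qadd v w : q (v + w) = q v + q w.
  apply/eqP; rewrite eq_le qD /=.
  pose S v := [set a | exists2 t, 0 <= t & q (v + t *: w) - t * q w <= a].
  have cS : proper_cone S.
    split.
    - by move=> z; exists (q (z + 0 *: w) - 0 * q w), 0.
    - move=> z z' a b [t t0 ta] [t' t'0 t'b]; exists (t + t'); first exact: addr_ge0.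
      have := qD (z + t *: w) (z' + t' *: w).
      by rewrite scalerDl addrACA; nra.
    - move=> r z a r0 [t t0 ta]; exists (r * t); first by rewrite mulr_ge0 // ltW.
      by rewrite -scalerA -scalerDr qZ // -mulrA -mulrBr ler_pM2l.
    - move=> a [t t0]; rewrite add0r; move: t0; rewrite le_eqVlt => /orP[/eqP <-|t0].
        by rewrite scale0r q0 mul0r subr0.
      by rewrite qZ // subrr.
  have Sq z : inf (S z) <= q z.
    by apply: proper_cone_inf_le => //; exists 0 => //; rewrite scale0r addr0 mul0r subr0.
  have := qmin _ (sublinear_inf cS) Sq v.
  rewrite -lerBrDr => /le_trans; apply; apply: proper_cone_inf_le => //.
  by exists 1 => //; rewrite scale1r mul1r.
have qN v : q (- v) = - q v by have := qadd v (- v); rewrite subrr q0; lra.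
move=> r v w; rewrite qadd; congr (_ + _).
have [r0|r0|->] := ltgtP r 0; last by rewrite !scale0r.
- by rewrite -[r in LHS]opprK scaleNr qN qZ ?oppr_gt0 // mulNr opprK.
- exact: qZ.
Qed.

End HahnBanach.

(** * Real-linear functionals on a complex space *)

Section Realified.
Context (R : realType) (c : scalar_kind) (X : lmodType (scalar_field R c)).

(** Restriction of scalars to R. *)
Definition realified : Type := X.
HB.instance Definition _ := GRing.Zmodule.on realified.

Definition real_scale (r : R) (x : realified) : realified :=
  (of_real r : scalar_field R c) *: (x : X).

Lemma real_scaleA r s x : real_scale r (real_scale s x) = real_scale (r * s) x.
Proof. by rewrite /real_scale scalerA of_realM. Qed.

Lemma real_scale1 : left_id 1 real_scale.
Proof. by move=> x; rewrite /real_scale of_real1 scale1r. Qed.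

Lemma real_scaleDr : right_distributive real_scale +%R.
Proof. by move=> r x y; rewrite /real_scale scalerDr. Qed.

Lemma real_scaleDl x : {morph real_scale^~ x : r s / r + s}.
Proof. by move=> r s; rewrite /real_scale of_realD scalerDl. Qed.

HB.instance Definition _ := GRing.Zmodule_isLmodule.Build R realified
  real_scaleA real_scale1 real_scaleDr real_scaleDl.

End Realified.

Section RealPart.
Context (R : realType) (c : scalar_kind) (X : completeNormedModType (scalar_field R c)).
Local Notation K := (scalar_field R c).

(** Over the complex numbers, u is the real part of x |-> u x - i u (i x). *)
Lemma dual_of_real_linear (u : realified X -> R^o) (M : R) : linear u ->
  (forall x, `|u x| <= M * rnorm (x : X)) ->
  exists2 psi, dual X psi & forall x, re (psi x) = u x.
Proof.
move=> lu uM.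
have uD x y : u (x + y) = u x + u y by rewrite -[x in LHS]scale1r lu scale1r.
have u0 : u 0 = 0 by apply: (addrI (u 0)); rewrite -uD !addr0.
have uZ r (x : X) : u ((of_real r : K) *: x) = r * u x.
  by have := lu r x 0; rewrite u0 !addr0.
(* The two kinds of scalars are told apart by the existence of an imaginary unit. *)
have [[j rj ij]|real_case] := pselect (exists2 j : K, re j = 0 & im j = 1); last first.
  have a_real (a : K) : a = of_real (re a).
    case: (c) a real_case => // a []; exists ('i%C : R[i]) => //.
  exists (fun x => of_real (u x)) => [|x]; last by rewrite re_of_real.
  apply: (@bounded_dual _ _ _ _ M) => [a x y|x]; last by rewrite abs_of_real.
  by rewrite (a_real a) uD uZ of_realD of_realM.
have jj : j * j = - 1 by apply: scalar_eq; rewrite !re_imE rj ij; ring.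
have split_scale (a : K) (z : X) :
    a *: z = (of_real (re a) : K) *: z + (of_real (im a) : K) *: (j *: z).
  rewrite scalerA -scalerDl; congr (_ *: _).
  by apply: scalar_eq; rewrite !re_imE rj ij; ring.
have ujj x : u (j *: (j *: x)) = - u x.
  have N1 : - 1 = of_real (- 1) :> K by apply: scalar_eq; rewrite !re_imE ?oppr0.
  by rewrite scalerA jj N1 uZ mulN1r.
have [psi re_psi im_psi] : exists2 psi : X -> K^o,
    forall x, re (psi x) = u x & forall x, im (psi x) = - u (j *: x).
  exists (fun x => of_real (u x) - j * of_real (u (j *: x))) => x;
    rewrite !re_imE rj ij; ring.
exists psi => //; apply: (@bounded_dual _ _ _ _ (2 * M)) => [a x y|x].
  have ua z : u (a *: z) = re a * u z + im a * u (j *: z).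
    by rewrite split_scale uD !uZ.
  have uja z : u (j *: (a *: z)) = re a * u (j *: z) - im a * u z.
    by rewrite scalerA mulrC -scalerA ua ujj; ring.
  apply: scalar_eq; rewrite -[a *: psi x]/(a * psi x) !re_imE !re_psi !im_psi ?scalerDr;
    rewrite !uD ?ua ?uja; ring.
have M0 : 0 <= M * rnorm x by exact: le_trans (uM x).
have nix : rnorm (j *: x) = rnorm x.
  by rewrite rnormZ rnormE rj ij expr0n expr1n add0r sqrtr1 mul1r.
have := uM (j *: x); rewrite nix => ui; have ux := uM x.
rewrite rnormE re_psi im_psi -[leRHS]ger0_norm; last by rewrite -mulrA mulr_ge0.
rewrite -sqrtr_sqr ler_wsqrtr // sqrrN -(real_normK (num_real (u x))).
rewrite -(real_normK (num_real (u (j *: x)))).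
have := normr_ge0 (u x); have := normr_ge0 (u (j *: x)); nra.
Qed.

End RealPart.

(** * Lines that are L-summands of the dual *)

Section LAtom.
Context (R : realType) (c : scalar_kind) (X : completeNormedModType (scalar_field R c)).
Local Notation K := (scalar_field R c).
Implicit Types (f g e : X -> K^o) (x y : X) (a : (X -> K^o) -> K).

(** The line spanned by e is an L-summand of the dual, and the L-projection
    onto it is f |-> a f *: e. *)
Definition L_atom e a : Prop :=
  [/\ dual X e, a e = 1,
      forall (k : K) f g, dual X f -> dual X g -> a (k *: f + g) = k * a f + a g
    & forall f, dual X f -> dual_norm f = rnorm (a f : K^o) + dual_norm (f - a f *: e)].

Lemma L_atom_residual e a f : L_atom e a -> dual X f -> dual X (f - a f *: e).
Proof. by move=> [de _ _ _] df; apply: dualB => //; exact: dualZ. Qed.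

Lemma L_atom_coef_le e a f : L_atom e a -> dual X f -> rnorm (a f : K^o) <= dual_norm f.
Proof.
move=> ea df; have [de _ _ ->] // := ea.
by rewrite lerDl dual_norm_ge0 //; exact: L_atom_residual.
Qed.

Lemma L_atom_norm e a : L_atom e a -> dual_norm e = 1.
Proof.
move=> [de ae _ aN]; rewrite aN // ae scale1r subrr.
by rewrite dual_norm0 addr0 -of_real1 abs_of_real normr1.
Qed.

(** Since the sum is an l1-sum, prescribing the value at the atom and keeping x
    elsewhere does not leave the bidual ball. *)
Lemma bidual_ball_patch e a (s : K) x : L_atom e a -> rnorm (s : K^o) <= 1 ->
  unit_ball X x -> bidual_ball (fun f => a f * s + (f x - a f * e x)).
Proof.
move=> ea s1 xB; have [de ae alin aN] := ea; split=> [k f g df dg|f df].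
  by rewrite alin // -[(k *: f + g) x]/(k * f x + g x); ring.
rewrite aN //; apply: le_trans (ler_rnormD _ _) _; apply: lerD.
  by rewrite absM ler_piMr // rnorm_ge0.
exact: dual_norm_ub (L_atom_residual ea df) xB.
Qed.

(** The functional e is maximised over the points of the unit ball within d of x1. *)
Section Constrained.
Variables (e : X -> K^o) (x1 : X) (d : R).
Hypotheses (de : dual X e) (x1B : unit_ball X x1) (d0 : 0 < d).

Let D : set X := [set x | unit_ball X x /\ rnorm (x1 - x) <= d].
Let g0 := sup [set re (e x) | x in D].

Lemma constrained_has_sup : has_sup [set re (e x) | x in D].
Proof.
split; first by exists (re (e x1)), x1 => //; split; rewrite ?subrr ?rnorm0 ?ltW.
exists (dual_norm e) => _ [x [xB _] <-].
by apply: le_trans (re_le_abs _) _; exact: dual_norm_ub.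
Qed.

Lemma constrained_le x : D x -> re (e x) <= g0.
Proof. by move=> Dx; apply: sup_upper_bound; [exact: constrained_has_sup|exists x]. Qed.

(** The constraint is relaxed to x - w = v, where w is within d of x1. The lower
    envelope of S is the directional derivative at v = 0 of the resulting loss in
    the value of the problem. *)
Let S (v : realified X) : set R := [set b | exists r x w, [/\ 0 < r, unit_ball X x,
  rnorm (x1 - w) <= d, v = r *: (x - w : realified X) & b = r * (g0 - re (e x))]].

Lemma constrained_cone : proper_cone S.
Proof.
have [le ce] := de.
split.
- move=> v; pose r := rnorm (v : X) / d + 1.
  have r0 : 0 < r by rewrite ltr_wpDl // divr_ge0 ?rnorm_ge0 // ltW.
  exists (r * (g0 - re (e x1))), r, x1, (x1 - r^-1 *: v : realified X); split=> //.
    rewrite subKr rnormZr ger0_norm ?invr_ge0 ?(ltW r0) // mulrC ler_pdivrMr //.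
    by rewrite /r mulrDr mulr1 mulrCA divff ?gt_eqF // mulr1 lerDl ltW.
  by rewrite subKr scalerA divff ?gt_eqF // scale1r.
- move=> v w a b [r [x [y [r0 xB yd -> ->]]]] [r' [x' [y' [r'0 x'B y'd -> ->]]]].
  have rr : 0 < r + r' by exact: addr_gt0.
  pose t := r / (r + r').
  have t01 : 0 <= t <= 1.
    by rewrite /t ler_pdivrMr // mul1r lerDl (ltW r'0) andbT divr_ge0 // ltW.
  have rE : r = (r + r') * t by rewrite /t; field; rewrite gt_eqF.
  have r'E : r' = (r + r') * (1 - t) by rewrite /t; field; rewrite gt_eqF.
  move: t t01 rE r'E => t t01 rE r'E.
  exists (r + r'), (of_real t *: x + of_real (1 - t) *: x'),
    (of_real t *: y + of_real (1 - t) *: y'); split=> //.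
  + exact: unit_ball_convex.
  + have -> : x1 - (of_real t *: y + of_real (1 - t) *: y') =
        of_real t *: (x1 - y) + of_real (1 - t) *: (x1 - y').
      rewrite !scalerBr addrACA -scalerDl -of_realD [t + _]addrC subrK of_real1 scale1r.
      by rewrite opprD.
    apply: le_trans (ler_rnormD _ _) _; case/andP: t01 => t0 t1.
    rewrite !rnormZr !ger0_norm ?subr_ge0 //; nra.
  + transitivity (((r + r') * t) *: (x - y : realified X) +
        ((r + r') * (1 - t)) *: (x' - y' : realified X)); first by rewrite -rE -r'E.
    rewrite -!scalerA -scalerDr; congr (_ *: _).
    transitivity ((of_real t : K) *: (x - y) + (of_real (1 - t) : K) *: (x' - y')); first exact: erefl.
    by rewrite !scalerBr addrACA -opprD.
  + transitivity ((r + r') * t * (g0 - re (e x)) + (r + r') * (1 - t) * (g0 - re (e x'))).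
      by rewrite -rE -r'E.
    by rewrite linear_funD // !linear_funZ // !re_imE; ring.
- move=> r v a r0 [r' [x [y [r'0 xB yd -> ->]]]].
  exists (r * r'), x, y; split => //; [exact: mulr_gt0|exact: scalerA|exact: mulrA].
- move=> a [r [x [y [r0 xB yd /eqP vE ->]]]].
  move: vE; rewrite eq_sym scaler_eq0 (gt_eqF r0) subr_eq0 => /eqP xy.
  by rewrite pmulr_rge0 // subr_ge0; apply: constrained_le; split=> //; rewrite xy.
Qed.

(** By Hahn-Banach, the constraint that x stays within d of x1 has a Lagrange
    multiplier psi: in real parts, e x + psi x <= g0 + psi w for all x in the ball
    and all w within d of x1. Optimising over x and w gives the two norms. *)
Lemma constrained_multiplier : exists2 psi, dual X psi &
  dual_norm (e + psi) + d * dual_norm psi <= g0 + re (psi x1).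
Proof.
have [u lu up] := hahn_banach (sublinear_inf constrained_cone).
have uD (x y : X) : u (x + y) = u x + u y by have := lu 1 x y; rewrite !scale1r.
have u0 : u 0 = 0 by apply: (addrI (u 0)); rewrite -uD !addr0.
have uZ r (x : X) : u ((of_real r : K) *: x) = r * u x.
  by have := lu r x 0; rewrite u0 !addr0.
have uB (x y : X) : u (x - y) = u x - u y.
  by rewrite -[y in LHS](scale1r y) -scaleNr -of_real1 -of_realN uD uZ mulN1r.
have ule x w : unit_ball X x -> rnorm (x1 - w) <= d -> u (x - w) <= g0 - re (e x).
  move=> xB wd; apply: le_trans (up _) _; apply: proper_cone_inf_le constrained_cone _.
  by exists 1, x, w; rewrite scale1r mul1r.
have udle b x : unit_ball X b -> unit_ball X x ->
    re (e x) + u x <= g0 + u x1 - d * u b.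
  move=> bB xB; have /(ule _ _ xB) : rnorm (x1 - (x1 - of_real d *: b)) <= d.
    by rewrite subKr rnormZr ger0_norm ?(ltW d0) // ler_piMr ?(ltW d0).
  by rewrite !uB uZ; lra.
pose M := (g0 - re (e x1)) / d.
have ub b : unit_ball X b -> `|u b| <= M.
  move=> bB; have := udle b x1 bB x1B; have bB' : unit_ball X (- b) by rewrite /unit_ball /= rnormN.
  have := udle (- b) x1 bB' x1B.
  rewrite -[- b]sub0r uB u0 /M => h1 h2.
  by rewrite ler_norml -mulNr ler_pdivrMr // ler_pdivlMr //; apply/andP; split; lra.
have uM x : `|u x| <= M * rnorm (x : X).
  have [x0|x0] := eqVneq (rnorm (x : X)) 0.
    by rewrite (rnorm_eq0 x0) u0 normr0 rnorm0 mulr0.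
  have xp : 0 < rnorm (x : X) by rewrite lt_neqAle eq_sym x0 rnorm_ge0.
  rewrite -ler_pdivrMr //; have /ub : unit_ball X (of_real (rnorm (x : X))^-1 *: (x : X)).
    by rewrite /unit_ball /= rnormZr ger0_norm ?invr_ge0 ?rnorm_ge0 // mulVf.
  have i0 : 0 <= (rnorm (x : X))^-1 by rewrite invr_ge0 rnorm_ge0.
  by rewrite uZ normrM (ger0_norm i0) mulrC.
have [psi dpsi psiu] := dual_of_real_linear lu uM; exists psi => //.
have [[lpsi _] [le _]] := (dpsi, de).
rewrite psiu -lerBrDl mulrC -ler_pdivlMr //.
apply: dual_norm_re_le => // b bB; rewrite psiu ler_pdivlMr // lerBrDl mulrC -lerBrDr.
apply: dual_norm_re_le => [|x xB]; first by case: (dualD de dpsi).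
by rewrite -[(e + psi) x]/(e x + psi x) reD psiu; exact: udle.
Qed.

End Constrained.

(** In the bidual, patching x1 with the value 1 at the atom moves x1 by at most d
    and reaches e = 1; the multiplier prevents the supremum of re e over the points
    of the ball of X within d of x1 from being smaller than 1. *)
Lemma L_atom_improve e a x1 (d k : R) : L_atom e a -> unit_ball X x1 -> 0 < d -> 0 < k ->
  rnorm (1 - e x1 : K^o) <= d ->
  exists x, [/\ unit_ball X x, rnorm (x1 - x) <= d & rnorm (1 - e x : K^o) < k].
Proof.
move=> ea x1B d0 k0 ex1; have [de ae alin aN] := ea.
have [psi dpsi] := constrained_multiplier de x1B d0; set g0 := sup _ => psi_le.
have g1 : 1 <= g0.
  have n1 : rnorm (1 : K^o) <= 1 by rewrite -of_real1 abs_of_real normr1.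
  have BPhi := bidual_ball_patch ea n1 x1B.
  have := le_trans (re_le_abs _) (BPhi.2 _ (dualD de dpsi)).
  have -> : a (e + psi) = 1 + a psi.
    by have := alin 1 _ _ de dpsi; rewrite scale1r ae mul1r.
  rewrite -[(e + psi) x1]/(e x1 + psi x1).
  have -> : (1 + a psi) * 1 + (e x1 + psi x1 - (1 + a psi) * e x1) =
      1 + psi x1 + a psi * (1 - e x1) by ring.
  rewrite !reD re1; have := ler_re_abs (a psi * (1 - e x1)); rewrite absM ler_norml.
  move=> /andP[h _]; have := L_atom_coef_le ea dpsi.
  have := rnorm_ge0 (1 - e x1 : K^o); have := rnorm_ge0 (a psi : K^o).
  move: h psi_le ex1; move: (rnorm (1 - _)) (rnorm (a psi)) => p q *.
  by nra.
have k2 : 0 < k ^+ 2 / 4 by rewrite divr_gt0 // exprn_gt0.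
have [_ [x [xB xd] <-]] := sup_adherent k2 (constrained_has_sup de x1B d0).
rewrite -/g0 => ex; exists x; split=> //.
(* As |e x| <= 1, the squared distance from e x to 1 is at most 2 (1 - re (e x)). *)
rewrite -(ltr_pXn2r (_ : 0 < 2)%N) ?nnegrE ?rnorm_ge0 ?(ltW k0) // abs_sqr !re_imE.
have := dual_norm_ub de xB; rewrite (L_atom_norm ea).
rewrite -(ler_pXn2r (_ : 0 < 2)%N) ?nnegrE ?rnorm_ge0 // abs_sqr; nra.
Qed.

End LAtom.

Section Attain.
Context (R : realType) (c : scalar_kind) (X : completeNormedModType (scalar_field R c)).
Local Notation K := (scalar_field R c).
Implicit Types (e : X -> K^o) (x : X) (a : (X -> K^o) -> K).

Lemma geometric_cvg (s : nat -> X) (d : R) : 0 < d ->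
  (forall n, rnorm (s n - s n.+1) <= d / 2 ^+ n) ->
  exists2 l : X, forall k, 0 < k -> exists N, forall n, (N <= n)%N -> rnorm (l - s n) < k
    & rnorm (s 0%N - l) <= 2 * d.
Proof.
move=> d0 sd; have p2 n : 0 < 2 ^+ n :> R by rewrite exprn_gt0.
have tail m n : rnorm (s m - s (m + n)%N) <= 2 * d / 2 ^+ m - 2 * d / 2 ^+ (m + n).
  elim: n => [|n IH]; first by rewrite addn0 !subrr rnorm0.
  apply: le_trans (rnorm_triangle _ (s (m + n)%N) _) _; rewrite addnS.
  (* The bound telescopes: d / 2 ^ n = 2 d / 2 ^ n - 2 d / 2 ^ (n + 1). *)
  have -> : 2 * d / 2 ^+ (m + n).+1 = d / 2 ^+ (m + n).
    by rewrite exprS; field; rewrite gt_eqF.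
  have := sd (m + n)%N; move: IH.
  rewrite -[in leRHS](mulrA 2 d) [X in _ <= _ - X](_ : _ = 2 * (d / 2 ^+ (m + n))) ?mulrA //.
  rewrite -!mulrA; lra.
have tail_le m n : rnorm (s m - s (m + n)%N) <= 2 * d / 2 ^+ m.
  by apply: le_trans (tail m n) _; rewrite gerBl divr_ge0 ?mulr_ge0 // ltW.
have small k : 0 < k -> exists N, 2 * d / 2 ^+ N < k.
  move=> k0; exists (Num.truncn (2 * d / k)).+1; rewrite ltr_pdivrMr // [k * _]mulrC -ltr_pdivrMr //.
  apply: lt_le_trans (truncnS_gt _) _.
  by rewrite -natrX ler_nat ltnW // ltn_expl.
have cs : cvg (s @ \oo).
  apply/cauchy_cvgP/cauchy_exP => k /= k0.
  have kE := of_real_ge0E (ltW k0).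
  have rk0 : 0 < re k by rewrite -(of_real_lt c) -kE of_real0.
  have [N Nk] := small _ rk0; exists (s N); exists N => // n /= Nn.
  rewrite -ball_normE /= normr_of_real kE of_real_lt; apply: le_lt_trans Nk.
  by rewrite -(subnKC Nn).
have near_lim k : 0 < k -> exists N, forall n, (N <= n)%N -> rnorm (lim (s @ \oo) - s n) < k.
  move=> k0; have /cs [N _ h] : nbhs (lim (s @ \oo)) [set y | rnorm (lim (s @ \oo) - y) < k].
    by apply/nbhs_rnormP; exists k.
  by exists N => n; exact: h.
exists (lim (s @ \oo)) => //; apply/ler_addgt0Pr => k k0.
have [N /(_ _ (leqnn _)) Nk] := near_lim k k0.
apply: le_trans (rnorm_triangle _ (s N) _) _; rewrite lerD //; last by rewrite rnormB ltW.
by have := tail_le 0%N N; rewrite expr0 divr1.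
Qed.

(** Improving x1 again and again, with the defect |1 - e x| halved each time, gives a
    sequence whose steps are bounded by the defects, hence convergent. *)
Lemma L_atom_attain e a x1 (d : R) : L_atom e a -> unit_ball X x1 -> 0 < d ->
  rnorm (1 - e x1 : K^o) < d ->
  exists x, [/\ unit_ball X x, e x = 1 & rnorm (x1 - x) <= 2 * d].
Proof.
move=> ea x1B d0 ex1; have [de _ _ _] := ea; have [le _] := de.
have p2 n : 0 < 2 ^+ n :> R by rewrite exprn_gt0.
pose P n x := unit_ball X x /\ rnorm (1 - e x : K^o) < d / 2 ^+ n.
have step n x : exists y, P n x -> P n.+1 y /\ rnorm (x - y) <= d / 2 ^+ n.
  have [[xB xe]|nP] := pselect (P n x); last by exists 0.
  have dn m : 0 < d / 2 ^+ m by exact: divr_gt0.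
  by have [y [yB xy ye]] := L_atom_improve ea xB (dn n) (dn n.+1) (ltW xe); exists y.
have [F FP] := choice (fun nx => step nx.1 nx.2).
pose s := fix s n := if n is m.+1 then F (m, s m) else x1.
have sP n : P n (s n).
  elim: n => [|n IH]; first by rewrite /P expr0 divr1.
  by have [] := FP (n, s n) IH.
have sd n : rnorm (s n - s n.+1) <= d / 2 ^+ n by have [] := FP (n, s n) (sP n).
have [l cvl sl] := geometric_cvg d0 sd; exists l; split=> //.
  apply/ler_addgt0Pr => k k0; have [N /(_ _ (leqnn _)) Nk] := cvl k k0.
  rewrite -[l](subrK (s N)) addrC; apply: le_trans (ler_rnormD _ _) _.
  by have [sB _] := sP N; apply: lerD; [exact: sB|exact: ltW].
apply/eqP; rewrite -subr_eq0 -opprB oppr_eq0; apply/eqP/rnorm_eq0/eqP.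
rewrite eq_le rnorm_ge0 andbT; apply/ler_addgt0Pr => k k0; rewrite add0r.
have k2 : 0 < k / 2 by rewrite divr_gt0.
have [N1 N1k] := cvl _ k2.
pose N := maxn N1 (Num.truncn (d / (k / 2))).+1.
apply: le_trans (rnorm_triangle _ (e (s N)) _) _.
have dN : d / 2 ^+ N < k / 2.
  rewrite ltr_pdivrMr // mulrC -ltr_pdivrMr //.
  apply: lt_le_trans (truncnS_gt _) _.
  by rewrite -natrX ler_nat (leq_trans (leq_maxr N1 _)) // ltnW // ltn_expl.
have sN := (sP N).2; have lN := N1k _ (leq_maxl _ _ : (N1 <= N)%N).
have eN : rnorm (e (s N) - e l : K^o) <= rnorm (l - s N).
  rewrite -linear_funB //; apply: le_trans (dual_normP _ de) _.
  by rewrite (L_atom_norm ea) mul1r rnormB.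
rewrite [k]splitr; apply: lerD; first exact: ltW (lt_trans sN dN).
exact: le_trans eN (ltW lN).
Qed.

End Attain.

(** * Extremal integrable functions *)

Section L1Functions.
Context (R : realType) (c : scalar_kind) (d : measure_display) (T : measurableType d).
Variable mu : {measure set T -> \bar R}.
Local Notation K := (scalar_field R c).
Local Notation L1fun := (@L1fun R c d T mu).
Implicit Types (f g h : L1fun) (v w : T -> R).

Lemma L1fun_measurable f : measurable_scalar (f : T -> K^o).
Proof. by have := L1fun_prop f; rewrite inE => -[]. Qed.

Lemma L1fun_integrable f : mu.-integrable setT (EFin \o (fun t => rnorm (f t))).
Proof.
have := L1fun_prop f; rewrite inE => -[mf ioo]; apply/integrableP; split.
  exact: measurable_rnorm.
apply: le_lt_trans ioo; apply: ge0_le_integral => //.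
- by apply: measurableT_comp => //; exact: measurable_rnorm.
- exact: measurable_rnorm.
- by move=> t _; rewrite /= ger0_norm ?rnorm_ge0.
Qed.

Lemma measurable_rnormL1 f : measurable_fun setT (fun t => rnorm (f t)).
Proof. by apply/measurable_EFinP; exact/measurable_rnorm/L1fun_measurable. Qed.

Lemma integrable_mul_bounded v g (M : R) : measurable_fun setT v ->
  (forall t, `|v t| <= M) -> mu.-integrable setT (EFin \o (fun t => v t * rnorm (g t))).
Proof.
move=> mv vM; have iM := integrableZl measurableT M (L1fun_integrable g).
apply: le_integrable iM => //.
  apply/measurable_EFinP; apply: measurable_funM => //; exact: measurable_rnormL1.
move=> t _ /=; rewrite lee_fin normrM [leRHS]normrM ler_wpM2r //.
exact: le_trans (vM t) (ler_norm M).
Qed.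

Lemma integrable_scaled (k : R) g :
  mu.-integrable setT (EFin \o (fun t => k * rnorm (g t))).
Proof.
exact: (@integrable_mul_bounded (cst k) g `|k|).
Qed.

Lemma L1fun_mul_bounded v g (M : R) : measurable_fun setT v ->
  (forall t, `|v t| <= M) -> exists h, forall t, h t = of_real (v t) * g t.
Proof.
move=> mv vM; have [mr mi] := L1fun_measurable g.
suff hL1 : (fun t => of_real (v t) * g t : K^o) \in @L1_integrable R c d T mu.
  by exists (MkL1fun hL1).
rewrite inE; split; first split.
- rewrite (_ : _ \o _ = (fun t => v t * re (g t))); first exact: measurable_funM.
  by apply/funext => t /=; rewrite !re_imE mul0r subr0.
- rewrite (_ : _ \o _ = (fun t => v t * im (g t))); first exact: measurable_funM.
  by apply/funext => t /=; rewrite !re_imE mul0r addr0.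
- have /integrableP[_] := integrable_mul_bounded g mv vM.
  rewrite /int_norm; under eq_integral do rewrite /= normrM (ger0_norm (rnorm_ge0 _)).
  by under [in X in _ -> X]eq_integral do rewrite absM abs_of_real.
Qed.

Lemma int_rnorm_eq0 f : \int[mu]_t rnorm (f t) = 0 -> {ae mu, forall t, f t = 0}.
Proof.
move=> f0; have if1 := integrable_fin_num measurableT (L1fun_integrable f).
have /ae_eq_integral_abs : measurable_fun setT (EFin \o (fun t => rnorm (f t))).
  exact/measurable_rnorm/L1fun_measurable.
move=> /(_ mu measurableT)[+ _].
under eq_integral do rewrite /= ger0_norm ?rnorm_ge0 //.
rewrite -(fineK if1) /= -[fine _]/(\int[mu]_t rnorm (f t)) f0 => /(_ erefl).
by apply: filterS => t /(_ I) [] /rnorm_eq0.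
Qed.

Lemma ae_eq_int_rnorm f g : {ae mu, forall t, f t = g t} ->
  \int[mu]_t rnorm (f t) = \int[mu]_t rnorm (g t).
Proof. by move=> /L1_pi_eq fg; rewrite -[LHS]L1_norm_pi fg L1_norm_pi. Qed.

(** The functions a *: g and h - a *: g have disjoint supports. *)
Lemma int_rnorm_split (a : K) g h : {ae mu, forall t, g t = 0 \/ h t = a * g t} ->
  \int[mu]_t rnorm (h t) =
  rnorm (a : K^o) * \int[mu]_t rnorm (g t) + \int[mu]_t rnorm ((h - a *: g) t).
Proof.
move=> hag; rewrite -RintegralZl //; last exact: L1fun_integrable.
have iag : mu.-integrable setT (EFin \o (fun t => rnorm (a : K^o) * rnorm (g t))).
  exact: integrable_scaled.
rewrite -RintegralD //; last exact: L1fun_integrable.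
congr fine; apply: ge0_ae_eq_integral => //.
- exact/measurable_rnorm/L1fun_measurable.
- apply/measurable_EFinP; apply: measurable_funD; last exact: measurable_rnormL1.
  by apply: measurable_funM => //; exact: measurable_rnormL1.
- by move=> t _; rewrite lee_fin rnorm_ge0.
- by move=> t _; rewrite lee_fin addr_ge0 ?mulr_ge0 ?rnorm_ge0.
apply: filterS hag => t + _; rewrite -[(h - a *: g) t]/(h t - a * g t) /=.
by case=> ->; rewrite ?mulr0 ?subrr ?rnorm0 ?mulr0 ?subr0 ?addr0 ?add0r ?absM.
Qed.

(** This is what extremality in the unit ball says about the perturbations
    g (1 + w) and g (1 - w), whose norms are 1 because w has mean zero. *)
Definition real_extremal g : Prop := forall w h, measurable_fun setT w ->
  (forall t, `|w t| <= 2^-1) -> (forall t, h t = of_real (w t) * g t) ->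
  \int[mu]_t (w t * rnorm (g t)) = 0 -> {ae mu, forall t, h t = 0}.

Section Extremal.
Variable g : L1fun.
Hypotheses (g_ext : real_extremal g) (g1 : \int[mu]_t rnorm (g t) = 1).

Lemma extremal_support (P : T -> Prop) : {ae mu, forall t, P t} -> exists2 t, P t & g t != 0.
Proof.
move=> aeP; apply: contrapT => noP.
have : \int[mu]_t rnorm (g t) = \int[mu]_t rnorm ((0 : L1fun) t).
  apply: ae_eq_int_rnorm; apply: filterS aeP => t Pt; apply: contrapT => /eqP gt.
  by apply: noP; exists t.
rewrite g1 /Rintegral; under eq_integral do rewrite -[(0 : L1fun) _]/(0 : K^o) rnorm0.
by rewrite integral0 => /eqP; rewrite oner_eq0.
Qed.

(** The difference of v and its mean is bounded by 1/2 and has mean zero. *)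
Lemma extremal_const_small v : measurable_fun setT v -> (forall t, 0 <= v t <= 4^-1) ->
  exists k : R, {ae mu, forall t, g t = 0 \/ v t = k}.
Proof.
move=> mv v4; have vn t : `|v t| <= 4^-1 by case/andP: (v4 t) => v0 v1; rewrite ger0_norm.
have ivg := integrable_mul_bounded g mv vn; have ig := L1fun_integrable g.
pose k := \int[mu]_t (v t * rnorm (g t)); exists k.
have k0 : 0 <= k.
  by apply: Rintegral_ge0 => t _; rewrite mulr_ge0 ?rnorm_ge0 //; case/andP: (v4 t).
have k4 : k <= 4^-1.
  have -> : 4^-1 = \int[mu]_t (4^-1 * rnorm (g t)) by rewrite RintegralZl // g1 mulr1.
  apply: le_Rintegral => //; first exact: integrable_scaled.
  by move=> t _; rewrite ler_wpM2r ?rnorm_ge0 //; case/andP: (v4 t).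
have mw : measurable_fun setT (fun t => v t - k) by exact: measurable_funB.
have w2 t : `|v t - k| <= 2^-1.
  by have := v4 t; rewrite ler_norml => /andP[? ?]; apply/andP; split; lra.
have [h hE] := L1fun_mul_bounded g mw w2.
have : \int[mu]_t ((v t - k) * rnorm (g t)) = 0.
  rewrite (_ : (fun t => _) = fun t => v t * rnorm (g t) - k * rnorm (g t)).
    rewrite RintegralB //; last exact: integrable_scaled.
    by rewrite RintegralZl // g1 mulr1 subrr.
  by apply/funext => t; rewrite mulrBl.
move=> /(g_ext mw w2 hE); apply: filterS => t; rewrite hE => /eqP.
rewrite mulf_eq0 => /orP[/eqP vk|/eqP ->]; last by left.
by right; apply/eqP; rewrite -subr_eq0 -(re_of_real c (v t - k)) vk re0.
Qed.

(** The injective map r |-> expR (- expR r) / 4 reduces to bounded functions. *)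
Lemma extremal_const u : measurable_fun setT u ->
  exists k : R, {ae mu, forall t, g t = 0 \/ u t = k}.
Proof.
move=> mu_; pose v t := expR (- expR (u t)) / 4.
have mv : measurable_fun setT v.
  apply: measurable_funM => //; apply: measurableT_comp => //.
  by apply: measurableT_comp => //; exact: measurableT_comp.
have [|k vk] := extremal_const_small mv.
  move=> t; have e1 : expR (- expR (u t)) <= 1.
    by rewrite -[leRHS]expR0 ler_expR oppr_le0 expR_ge0.
  by rewrite /v divr_ge0 ?expR_ge0 //=; have := expR_ge0 (- expR (u t)); lra.
have [t0 [/eqP gt0|vt0] gt] := extremal_support vk; first by rewrite gt0 in gt.
exists (u t0); apply: filterS vk => t [->|vt]; [by left|right].
move: vt; rewrite -vt0 /v => /(mulIf _) vt; apply: expR_inj; apply: oppr_inj.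
by apply: expR_inj; apply: vt; rewrite invr_neq0.
Qed.

(** The quotient h / g is constant on the support of g. *)
Lemma extremal_proportional h : exists a : K, {ae mu, forall t, g t = 0 \/ h t = a * g t}.
Proof.
(* On the support of g this is the inverse of |g| ^ 2, in a form whose
   measurability is plain. *)
pose G t := expR (- ln (rnorm (g t) ^+ 2)).
have mG : measurable_fun setT G.
  apply: measurableT_comp => //; apply: measurableT_comp => //.
  apply: (@measurableT_comp _ _ _ _ _ _ (@ln R)) => //.
  by apply: measurable_funX; exact: measurable_rnormL1.
have GE t : g t != 0 -> of_real (G t) * scalar_conj (g t) * g t = 1.
  move=> gt; have g2 : 0 < rnorm (g t) ^+ 2.
    rewrite exprn_gt0 // lt_neqAle rnorm_ge0 andbT eq_sym.
    by apply: contra_neq gt => /rnorm_eq0.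
  by rewrite -mulrA mul_conj -of_realM /G expRN lnK // mulVf ?of_real1 // gt_eqF.
have [[gr gi] [hr hi]] := (L1fun_measurable g, L1fun_measurable h).
pose q t : K := of_real (G t) * scalar_conj (g t) * h t.
have mqr : measurable_fun setT (fun t => re (q t)).
  rewrite (_ : (fun t => _) = fun t => G t * (re (g t) * re (h t) + im (g t) * im (h t))).
    apply: measurable_funM => //.
    by apply: measurable_funD; apply: measurable_funM.
  by apply/funext => t; rewrite /q !re_imE; ring.
have mqi : measurable_fun setT (fun t => im (q t)).
  rewrite (_ : (fun t => _) = fun t => G t * (re (g t) * im (h t) - im (g t) * re (h t))).
    apply: measurable_funM => //.
    by apply: measurable_funB; apply: measurable_funM.
  by apply/funext => t; rewrite /q !re_imE; ring.
have [kr qr] := extremal_const mqr; have [ki qi] := extremal_const mqi.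
have qq : {ae mu, forall t, g t = 0 \/ (re (q t) = kr /\ im (q t) = ki)}.
  by apply: filterS2 qr qi => t [->|qr] [g0|qi]; [left|left|left|right].
have [t0 [/eqP gt0|[qr0 qi0]] gt] := extremal_support qq; first by rewrite gt0 in gt.
exists (q t0); apply: filterS qq => t [->|[qrt qit]]; first by left.
have [g0|gt1] := eqVneq (g t) 0; [by left|right].
have -> : q t0 = q t by apply: scalar_eq; rewrite ?qrt ?qit ?qr0 ?qi0.
by rewrite /q mulrAC GE // mul1r.
Qed.

End Extremal.
End L1Functions.

(** * Extreme points of the dual ball of an L1-predual *)

Section ExtremeAtoms.
Context (R : realType) (c : scalar_kind) (X : completeNormedModType (scalar_field R c)).
Local Notation K := (scalar_field R c).

Section Representation.
Context (d : measure_display) (T : measurableType d) (mu : {measure set T -> \bar R}).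
Variable phi : {linear L1 c mu -> (X -> K^o)}.
Hypotheses (phi_isom : forall u, dual_norm (phi u) = L1_norm u) (phi_onto : range phi = dual X).

Let F (h : L1fun c mu) : X -> K^o := phi (\pi_(L1 c mu) h)%qT.

Lemma repr_lin (a : K) h h' : F (a *: h + h') = a *: F h + F h'.
Proof. by rewrite /F L1_piD -L1_piZ linearP. Qed.

Lemma repr_dual h : dual X (F h).
Proof. by rewrite -phi_onto; exists (\pi_(L1 c mu) h)%qT. Qed.

Lemma repr_onto f : dual X f -> exists h, F h = f.
Proof. by rewrite -phi_onto => -[u _ <-]; have [h ->] := L1_piP u; exists h. Qed.

Lemma repr_norm h : dual_norm (F h) = \int[mu]_t rnorm (h t).
Proof. by rewrite phi_isom L1_norm_pi. Qed.

(** The point F g is the midpoint of F (g + h) and F (g - h). *)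
Lemma extreme_real_extremal g : extreme_points (dual_ball X) (F g) ->
  \int[mu]_t rnorm (g t) = 1 -> real_extremal g.
Proof.
move=> [_ g_ext] g1 w h mw w2 hE w0; apply: int_rnorm_eq0; rewrite -repr_norm.
have perturbed (s : R) : `|s| <= 1 -> dual_ball X (F ((of_real s : K) *: h + g)).
  move=> s1; split; first exact: repr_dual.
  rewrite /= repr_norm.
  have iswg : mu.-integrable setT (EFin \o (fun t => (s * w t) * rnorm (g t))).
    apply: (@integrable_mul_bounded _ _ _ _ _ _ _ 1) => [|t].
      exact: measurable_funM.
    by rewrite normrM mulr_ile1 // (le_trans (w2 t)) // invf_le1 // ler1n.
  have iwg : mu.-integrable setT (EFin \o (fun t => w t * rnorm (g t))).
    exact: integrable_mul_bounded w2.
  rewrite (_ : (fun t => _) = fun t => rnorm (g t) + s * (w t * rnorm (g t))).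
    rewrite RintegralD //; first by rewrite RintegralZl // w0 mulr0 addr0 g1.
      exact: L1fun_integrable.
    by move: iswg; under eq_fun do rewrite -mulrA.
  apply/funext => t; rewrite -[((of_real s : K) *: h + g) t]/((of_real s : K) * h t + g t).
  rewrite hE mulrA -of_realM -[X in _ + X]mul1r -(of_real1 R c) -mulrDl -of_realD.
  rewrite absM abs_of_real ger0_norm; first by ring.
  have : `|s * w t| <= 1.
    by rewrite normrM mulr_ile1 // (le_trans (w2 t)) // invf_le1 // ler1n.
  by rewrite ler_norml => /andP[? _]; lra.
have [||||+ _] := g_ext _ _ 2^-1 (perturbed 1 _) (perturbed (- 1) _).
- by rewrite normr1.
- by rewrite normrN normr1.
- by rewrite invr_gt0 ltr0n invf_lt1 ?ltr0n // ltr1n.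
- rewrite !repr_lin of_realN of_real1 scale1r scaleN1r.
  apply/funext => x.
  rewrite -[RHS]/(2^-1 * (F h x + F g x) + (1 - 2^-1) * (- F h x + F g x)).
  by field.
- rewrite repr_lin of_real1 scale1r => hg.
  have -> : F h = 0 by apply: (addIr (F g)); rewrite add0r.
  exact: dual_norm0.
Qed.

(** The coefficient of f at e is the constant value of the quotient of their
    densities on the support of the density of e. *)
Lemma repr_extreme_L_atom e : extreme_points (dual_ball X) e -> dual_norm e = 1 ->
  exists a, L_atom e a.
Proof.
move=> e_ext e1; have [g gE] := repr_onto e_ext.1.1; subst e.
have g1 : \int[mu]_t rnorm (g t) = 1 by rewrite -repr_norm.
have g_ext := extreme_real_extremal e_ext g1.
pose coef (f : X -> K^o) (k : K) := exists2 h, F h = f &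
  {ae mu, forall t, g t = 0 \/ h t = k * g t}.
have coef_lin (k : K) f f' (b b' : K) : coef f b -> coef f' b' ->
    coef (k *: f + f') (k * b + b').
  move=> [h <- hb] [h' <- hb']; exists (k *: h + h'); first exact: repr_lin.
  apply: filterS2 hb hb' => t [gt|hb] [gt'|hb']; [by left|by left|by left|right].
  by rewrite -[(k *: h + h') t]/(k * h t + h' t) hb hb'; ring.
have coef_norm f (b : K) : coef f b ->
    dual_norm f = rnorm (b : K^o) + dual_norm (f - b *: F g).
  move=> [h <- /int_rnorm_split hb]; rewrite repr_norm hb g1 mulr1; congr (_ + _).
  by rewrite -repr_norm [h - _]addrC -scaleNr repr_lin scaleNr addrC.
have coef_uniq f (b b' : K) : coef f b -> coef f b' -> b = b'.
  move=> fb fb'; apply/eqP; rewrite -subr_eq0; apply/eqP/(@rnorm_eq0 _ _ K^o)/eqP.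
  have := coef_norm _ _ (coef_lin (- 1) _ _ _ _ fb' fb).
  rewrite scaleN1r addNr dual_norm0 mulN1r [- b' + b]addrC => /eqP.
  rewrite eq_sym paddr_eq0 ?rnorm_ge0 //; first by case/andP.
  apply: dual_norm_ge0; apply: dualB; first exact: dual0.
  by apply: dualZ; exact: repr_dual.
have coef_ex f : exists b, dual X f -> coef f b.
  have [/repr_onto[h <-]|nd] := pselect (dual X f); last by exists 0.
  by have [b hb] := extremal_proportional g_ext g1 h; exists b => _; exists h.
have [a aP] := choice coef_ex; exists a; split.
- exact: repr_dual.
- apply: (coef_uniq (F g)); first exact/aP/repr_dual.
  by exists g => //; apply: aeW => t; right; rewrite mul1r.
- move=> k f f' df df'; apply: (coef_uniq (k *: f + f')); first exact/aP/dualP.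
  by apply: coef_lin; exact: aP.
- by move=> f df; apply: coef_norm; exact: aP.
Qed.

End Representation.

Theorem L1_predual_extreme_L_atom e : L1_predual X ->
  extreme_points (dual_ball X) e -> dual_norm e = 1 -> exists a, L_atom e a.
Proof. by move=> [d [T [mu [phi [isom onto]]]]]; exact: repr_extreme_L_atom. Qed.

End ExtremeAtoms.

(** * Light and heavy directions *)

Section Directions.
Context (R : realType) (c : scalar_kind) (X : completeNormedModType (scalar_field R c)).
Local Notation K := (scalar_field R c).
Implicit Types (e f g : X -> K^o) (x y : X) (a : (X -> K^o) -> K).

Lemma unimodularZ_dual_ball (k : K) f : rnorm (k : K^o) <= 1 -> dual X f ->
  dual_norm f = 1 -> dual_ball X (k *: f).
Proof. by move=> k1 df f1; split; [exact: dualZ|rewrite /= dual_normZ // f1 mulr1]. Qed.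

(** Otherwise e1 would be a proper convex combination of a multiple of e and of
    its normalised remainder. *)
Lemma L_atom_extreme_coef0 e a e1 : L_atom e a -> extreme_points (dual_ball X) e1 ->
  dual_norm e1 = 1 -> ~ lin_dep e1 e -> a e1 = 0.
Proof.
move=> ea [[de1 _] e1_ext] n1 indep; have [de ae alin aN] := ea.
have dr := L_atom_residual ea de1; set r := e1 - _ in dr.
have := aN e1 de1; rewrite -/r n1 => split1.
apply: contrapT => /eqP ae0; apply: indep.
have t0 : 0 < rnorm (a e1 : K^o).
  rewrite lt_neqAle rnorm_ge0 andbT eq_sym.
  by apply: contra_neq ae0 => /(@rnorm_eq0 _ _ K^o).
have [r0|r0] := eqVneq (dual_norm r) 0.
  exists 1, (- a e1); split; first by move=> [/eqP]; rewrite oner_eq0.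
  by rewrite scale1r scaleNr; exact: dual_norm_eq0 r0.
have rp : 0 < dual_norm r by rewrite lt_neqAle eq_sym r0 dual_norm_ge0.
have [u u1 uE] := exists_phase (a e1).
have aE : a e1 = of_real (rnorm (a e1 : K^o)) * scalar_conj u.
  by rewrite -uE mulrAC [u * _]mulrC mul_conj u1 expr1n of_real1 mul1r.
set t := rnorm (a e1 : K^o) in aE t0 split1.
have [||||ue _] := e1_ext (scalar_conj u *: e) (of_real (dual_norm r)^-1 *: r) (of_real t).
- by apply: unimodularZ_dual_ball; rewrite ?abs_conj ?u1 // (L_atom_norm ea).
- split; first exact: dualZ.
  by rewrite /= dual_normZ // abs_of_real ger0_norm ?invr_ge0 ?dual_norm_ge0 // mulVf.
- rewrite -(of_real0 R c) -(of_real1 R c) !of_real_lt t0 /=; lra.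
- rewrite !scalerA -aE -of_real1 -of_realB -of_realM.
  have -> : 1 - t = dual_norm r by lra.
  by rewrite mulfV // of_real1 scale1r addrC subrK.
- exists 1, (- scalar_conj u); split; first by move=> [/eqP]; rewrite oner_eq0.
  by rewrite scale1r -[in X in X + _]ue scaleNr subrr.
Qed.

(** Removing from f its component along one of the lines keeps the other
    coefficients and decreases the norm by the modulus of the coefficient. *)
Lemma sum_coef_le (e : nat -> X -> K^o) (a : nat -> (X -> K^o) -> K) f n :
  (forall i, L_atom (e i) (a i)) -> (forall i j, i != j -> a i (e j) = 0) -> dual X f ->
  \sum_(i < n) rnorm (a i f : K^o) <= dual_norm f.
Proof.
move=> ea orth; elim: n f => [|n IH] f df; first by rewrite big_ord0 dual_norm_ge0.
have [den _ _ ->] // := ea n; rewrite big_ord_recr /= addrC lerD2l.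
apply: le_trans (IH _ (L_atom_residual (ea n) df)); apply: ler_sum => i _.
have [_ _ alin _] := ea i; rewrite addrC -scaleNr alin //.
by rewrite orth ?mulr0 ?add0r // ltn_eqF.
Qed.

(** The coefficient a f is the mass, up to a phase, that f gives to the atom carrying
    e; its modulus depends on the direction of e only. *)
Definition heavy f (m : R) : set (sphere_quot X) :=
  [set q | exists (e : dual_sphere X) a, [/\ extreme_points (dual_ball X) (set_val e),
    L_atom (set_val e) a, sphere_proj X e = q & m <= rnorm (a f : K^o)]].

(** Infinitely many such directions would give arbitrarily large sums of moduli of
    coefficients, all bounded by the norm of f. *)
Lemma finite_heavy f (m : R) : dual X f -> 0 < m -> finite_set (heavy f m).
Proof.
move=> df m0; apply: contrapT => /infiniteP/card_leP/unsquash F.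
pose q n := set_val (F (to_setT n)); have qP n : heavy f m (q n) by exact: set_valP.
have q_inj : injective q.
  move=> i j /val_inj ij; have /(congr1 set_val) // : to_setT i = to_setT j.
  by apply: inj ij; rewrite inE.
have /choice[e /choice[a eaP]] := qP.
have ea i : L_atom (set_val (e i)) (a i) by case: (eaP i).
have orth i j : i != j -> a i (set_val (e j)) = 0.
  move=> ij; have [ej_ext _ qj _] := eaP j; have [_ _ qi _] := eaP i.
  apply: (L_atom_extreme_coef0 (ea i) ej_ext); first by case: (set_valP (e j)).
  move=> dep; move/eqP: ij; apply; apply: q_inj.
  by rewrite -qi -qj; apply/esym/eqmodP/asboolP.
have := sum_coef_le (Num.truncn (dual_norm f / m)).+1 ea orth df.
apply/negP; rewrite -ltNge; apply: lt_le_trans (_ : \sum_(i < (Num.truncn (dual_norm f / m)).+1) m <= _).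
  by rewrite sumr_const card_ord -mulr_natl -ltr_pdivrMr // truncnS_gt.
by apply: ler_sum => i _; case: (eaP i).
Qed.

(** Goldstine's theorem applied to the patched evaluation at x. *)
Lemma L_atom_patch e a x (s : K) (fs : seq (X -> K^o)) (m k : R) : L_atom e a -> unit_ball X x ->
  rnorm (s : K^o) <= 1 -> 0 < k -> (forall f, f \in fs -> dual X f /\ rnorm (a f : K^o) <= m) ->
  exists y, [/\ unit_ball X y, rnorm (s - e y : K^o) < k &
    forall f, f \in fs -> rnorm (f y - f x : K^o) < 2 * m + k].
Proof.
move=> ea xB s1 k0 fsP; have [de ae _ _] := ea.
have [|y yB yfs] := goldstine (fs := e :: fs) (bidual_ball_patch ea s1 xB) _ k0.
  by move=> f; rewrite in_cons => /orP[/eqP ->|/fsP[]].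
exists y; split=> //.
  have := yfs e (mem_head _ _); rewrite ae.
  by rewrite (_ : 1 * s + _ = s) //; ring.
move=> f ffs; have [df am] := fsP f ffs.
have ffs' : f \in e :: fs by rewrite in_cons ffs orbT.
have {yfs ffs'} yf := yfs f ffs'; rewrite rnormB.
have -> : f x - f y = (a f * s + (f x - a f * e x) - f y) + a f * (e x - s) by ring.
apply: le_lt_trans (ler_rnormD _ _) _; rewrite addrC; apply: ler_ltD => //.
rewrite absM mulrC; apply: ler_pM; rewrite ?rnorm_ge0 //.
apply: le_trans (ler_rnormD _ _) _; rewrite rnormN (_ : 2 = 1 + 1) // lerD //.
by have := dual_norm_ub de xB; rewrite (L_atom_norm ea).
Qed.

End Directions.

(** * Weak and weak* neighbourhoods *)

Lemma ptws_cvg (U : Type) (V : topologicalType) (F : set_system {ptws U -> V})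
    (f : {ptws U -> V}) : Filter F ->
  (forall t, (fun g : {ptws U -> V} => g t) @ F --> f t) -> F --> f.
Proof.
move=> FF Ff; apply/cvg_sup => t A [_ [[B oB <-] Bf] BA].
by apply: filterS BA _; apply: (Ff t); apply: open_nbhs_nbhs.
Qed.

Section Topologies.
Context (R : realType) (c : scalar_kind) (X : completeNormedModType (scalar_field R c)).
Local Notation K := (scalar_field R c).

(** The sets defined by finitely many functionals generate a filter that converges
    weakly to x. *)
Lemma weak_nbhs_finite (W : set X) x : rel_weakly_open W -> W x ->
  exists fs : seq (X -> K^o), exists e : R, [/\ forall f, f \in fs -> dual X f, 0 < e &
    forall y, unit_ball X y -> (forall f, f \in fs -> rnorm (f y - f x : K^o) < e) -> W y].
Proof.
move=> [U [A oA <-] ->] [xB Ax].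
pose ev y : {ptws dual X -> K^o} := fun f : dual X => set_val f y.
pose near_ev (i : seq (dual X) * R) : set {ptws dual X -> K^o} :=
  [set g | forall f, f \in i.1 -> rnorm (ev x f - g f : K^o) < i.2].
pose F := filter_from [set i : seq (dual X) * R | 0 < i.2] near_ev.
have FF : Filter F.
  apply: filter_from_filter => [|i j /= i0 j0]; first by exists ([::], 1) => /=.
  exists (i.1 ++ j.1, Num.min i.2 j.2); first by rewrite /= lt_min i0.
  move=> g /= gij; split=> f fi; have := gij f; rewrite mem_cat fi ?orbT /= => /(_ isT);
    by rewrite lt_min => /andP[].
have Fcvg : F --> (ev x).
  apply: ptws_cvg => f B /nbhs_rnormP[e e0 eB].
  exists ([:: f], e) => // g /(_ f); rewrite mem_head => /(_ isT) gf.
  exact: eB.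
have [i i0 iA] : F A by apply: Fcvg; apply: open_nbhs_nbhs.
exists [seq set_val f | f <- i.1], i.2; split=> // [f /mapP[g _ ->]|y yB yi].
  exact: set_valP.
split=> //; apply: iA => f fi; rewrite rnormB; apply: yi.
by apply/mapP; exists f.
Qed.

Lemma sphere_eval_continuous x : continuous (fun f : dual_sphere X => set_val f x : K^o).
Proof.
move=> f; have cv : {for f, continuous (set_val : dual_sphere X -> {ptws X -> K^o})}.
  exact: initial_continuous.
have cp : {for set_val f : {ptws X -> K^o}, continuous (@proj X (fun=> K^o) x : {ptws X -> K^o} -> K^o)}.
  exact: proj_continuous.
exact: continuous_comp cv cp.
Qed.

Lemma sphere_projP (f g : dual_sphere X) :
  sphere_proj X f = sphere_proj X g <-> lin_dep (set_val f) (set_val g).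
Proof. by split=> [/eqmodP/asboolP|fg]; last apply/eqmodP/asboolP. Qed.

Lemma sphere_proj_abs (f g : dual_sphere X) x : sphere_proj X f = sphere_proj X g ->
  rnorm (set_val f x : K^o) = rnorm (set_val g x : K^o).
Proof.
move=> /sphere_projP/(lin_depP (@dual_sphere_neq0 _ _ _ _) (@dual_sphere_neq0 _ _ _ _)).
move=> [a [b [a0 b0 fg]]]; have [[df f1] [dg g1]] := (set_valP f, set_valP g).
have fE : a *: set_val f = - b *: set_val g.
  by rewrite scaleNr; apply/eqP; rewrite -addr_eq0 fg.
have ab : rnorm (a : K^o) = rnorm (- b : K^o).
  by have := dual_normZ a df; rewrite fE dual_normZ // f1 g1 !mulr1.
have ap : rnorm (a : K^o) != 0 by apply: contra_neq a0 => /(@rnorm_eq0 _ _ K^o).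
apply: (mulfI ap); rewrite -absM -[a * _]/((a *: set_val f) x) fE ab -absM.
by [].
Qed.

(** The class of g is cut out of the sphere by the closed conditions
    f x * g y = f y * g x. *)
Lemma sphere_quot_accessible : accessible_space (sphere_quot X).
Proof.
apply/accessible_finite_set_closed; suff cl1 (q : sphere_quot X) : closed [set q].
  move=> A /finite_setP[n]; elim: n A => [|n IH] A.
    by rewrite II0 card_eq0 => /eqP ->; exact: closed0.
  move=> /eq_cardSP[q Aq /IH cA]; rewrite -(setD1K Aq).
  by apply: closedU.
have [g <-] : exists g, sphere_proj X g = q by exists (repr q); exact: reprK.
rewrite -openC.
change (open ((fun f => sphere_proj X f) @^-1` (~` [set sphere_proj X g]))).
rewrite -preimage_setC openC.
have -> : (fun f => sphere_proj X f) @^-1` [set sphere_proj X g] =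
    \bigcap_(z in [set: X * X]) [set f | set_val f z.1 * set_val g z.2 -
      set_val f z.2 * set_val g z.1 = 0].
  apply/seteqP; split=> f /= fg.
    move: fg => /sphere_projP/(lin_depP (@dual_sphere_neq0 _ _ _ _) (@dual_sphere_neq0 _ _ _ _)).
    move=> [a [b [a0 b0 fg]]] z _ /=.
    have fE x : a * set_val f x = - b * set_val g x.
      apply/eqP; rewrite mulNr -addr_eq0; apply/eqP.
      by have := congr1 (fun h => h x) fg.
    apply: (mulfI a0); rewrite mulr0 mulrBr !mulrA !fE; ring.
  have [y gy] : exists y, set_val g y <> 0.
    apply: contrapT => g0; apply: (@dual_sphere_neq0 _ _ _ g); apply/funext => y.
    by apply: contrapT => gy; apply: g0; exists y.
  apply/sphere_projP; exists (set_val g y), (- set_val f y); split.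
    by move=> [].
  apply/funext => x; have := fg (x, y) I => /= e.
  by rewrite -[LHS]/(set_val g y * set_val f x + - set_val f y * set_val g x) -[RHS]e; ring.
apply: closed_bigI => z _.
have cz u v : continuous (fun f : dual_sphere X => set_val f u * set_val g v : K^o).
  by move=> f; apply: (@cvgM K _ (nbhs f)); [exact: sphere_eval_continuous|exact: cvg_cst].
pose psi (f : dual_sphere X) : K^o :=
  set_val f z.1 * set_val g z.2 - set_val f z.2 * set_val g z.1.
apply: (@closed_comp _ _ psi [set 0]) => [f _|].
  by apply: (@cvgB K K^o _ (nbhs f)); exact: cz.
by apply: accessible_closed_set1; apply: hausdorff_accessible; exact: norm_hausdorff.
Qed.

Lemma open_abs_gt x (r : R) :
  open [set q : sphere_quot X | r < rnorm (set_val (repr q : dual_sphere X) x : K^o)].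
Proof.
change (open ((fun f => sphere_proj X f) @^-1`
  [set q : sphere_quot X | r < rnorm (set_val (repr q : dual_sphere X) x : K^o)])).
have -> : (fun f => sphere_proj X f) @^-1`
  [set q : sphere_quot X | r < rnorm (set_val (repr q : dual_sphere X) x : K^o)] =
    (fun f : dual_sphere X => set_val f x : K^o) @^-1` [set k | r < rnorm k].
  apply/seteqP; split=> f /=; rewrite (@sphere_proj_abs (repr _) f) //; exact: reprK.
apply: open_comp => [f _|]; first exact: sphere_eval_continuous.
rewrite openE => k /= rk; apply/nbhs_rnormP; exists (rnorm k - r); first by rewrite subr_gt0.
move=> k' kk; have := ler_rnormD (k - k') k'; rewrite subrK /=; lra.
Qed.

End Topologies.

(** * Peaks at cluster directions *)

Section Diametral.
Context (R : realType) (c : scalar_kind) (X : completeNormedModType (scalar_field R c)).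
Local Notation K := (scalar_field R c).
Hypothesis preX : L1_predual X.

Lemma EX_atom (p : EX X) : exists (e : dual_sphere X) a,
  [/\ sphere_proj X e = set_val p, extreme_points (dual_ball X) (set_val e) &
      L_atom (set_val e) a].
Proof.
have [e e_ext ep] := set_valP p; have [_ e1] := set_valP e.
by have [a ea] := L1_predual_extreme_L_atom preX e_ext e1; exists e, a.
Qed.

Lemma finite_heavy_union (fs : seq (X -> K^o)) (m : R) :
  (forall f, f \in fs -> dual X f) -> 0 < m ->
  finite_set (\bigcup_(f in [set` fs]) heavy f m).
Proof.
move=> dfs m0; apply: bigcup_finite => [|f ffs]; first exact: finite_seq.
by apply: finite_heavy => //; exact: dfs.
Qed.

(** A direction of EX' outside the finite set of directions that are heavy for one
    of the functionals describing W leaves room to prescribe the value 1 at it. *)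
Lemma exists_peak (W : set X) : infinite_set (EX' X) -> rel_weakly_open W -> W !=set0 ->
  exists (p : EX X) (e : dual_sphere X) x,
    [/\ EX' X p, sphere_proj X e = set_val p, W x & set_val e x = 1].
Proof.
move=> infE oW [y0 Wy0]; have y0B : unit_ball X y0 by case: oW Wy0 => [U _ ->] [].
have [fs [d [dfs d0 fsW]]] := weak_nbhs_finite oW Wy0.
have d8 : 0 < d / 8 by rewrite divr_gt0.
have finB := finite_heavy_union dfs d8.
have [p [pE' pB]] : exists p : EX X, EX' X p /\
    ~ (\bigcup_(f in [set` fs]) heavy f (d / 8)) (set_val p).
  set B := \bigcup_(f in _) _ in finB *.
  have finB' : finite_set (set_val @^-1` B : set (EX X)).
    by apply: finite_preimage finB => p q _ _ /val_inj.
  apply: contrapT => noP; apply: infE; apply: sub_finite_set finB' => p pE'.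
  by apply: contrapT => pB; apply: noP; exists p.
have [e [a [ep e_ext ea]]] := EX_atom p.
pose M := \sum_(f <- fs) dual_norm f.
have M0 : 0 <= M.
  by rewrite /M big_seq; apply: sumr_ge0 => f ffs; apply: dual_norm_ge0; exact: dfs.
have fM f : f \in fs -> dual_norm f <= M.
  move=> ffs; rewrite /M (big_rem f) //= lerDl big_seq; apply: sumr_ge0 => g gfs.
  by apply: dual_norm_ge0; apply: dfs; exact: mem_rem gfs.
(* Making e exactly 1 moves the values of the functionals of fs by at most 2 k M. *)
pose k := d / (8 * (M + 1)).
have k0 : 0 < k by rewrite divr_gt0 // mulr_gt0 // ltr_wpDl.
have kM : k * (M + 1) = d / 8 by rewrite /k; field; rewrite gt_eqF // ltr_wpDl.
have s1 : rnorm (1 : K^o) <= 1 by rewrite -(of_real1 R c) abs_of_real normr1.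
have [|y1 [y1B ey1 fy1]] := L_atom_patch (fs := fs) (m := d / 8) ea y0B s1 k0.
  move=> f ffs; split; first exact: dfs.
  rewrite leNgt; apply/negP => h; apply: pB; exists f => //.
  by exists e, a; split=> //; exact: ltW.
have [x [xB ex y1x]] := L_atom_attain ea y1B k0 ey1.
exists p, e, x; split=> //; apply: fsW => // f ffs.
have [lf _] := dfs f ffs.
have fx : rnorm (f x - f y1 : K^o) <= M * (2 * k).
  rewrite -linear_funB //; apply: le_trans (dual_normP _ (dfs f ffs)) _.
  by rewrite rnormB; apply: ler_pM => //; rewrite ?rnorm_ge0 ?dual_norm_ge0 ?fM //; exact: dfs.
apply: le_lt_trans (rnorm_triangle _ (f y1 : K^o) _) _.
by have := fy1 f ffs; nra.
Qed.

(** Near p there are directions of extreme points which are light for given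
    functionals and where x is almost of modulus 1. *)
Lemma exists_light_direction (p : EX X) (e : dual_sphere X) x (fs : seq (X -> K^o)) (m d : R) :
  EX' X p -> sphere_proj X e = set_val p -> set_val e x = 1 ->
  (forall f, f \in fs -> dual X f) -> 0 < m -> 0 < d ->
  exists e' a, [/\ L_atom e' a, 1 - d < rnorm (e' x : K^o) &
    forall f, f \in fs -> rnorm (a f : K^o) <= m].
Proof.
move=> pE' ep ex dfs m0 d0; have finB := finite_heavy_union dfs m0.
set B := \bigcup_(f in _) _ in finB.
(* Finitely many points are closed, and p itself is kept inside O even if heavy. *)
pose O := [set q : sphere_quot X | 1 - d < rnorm (set_val (repr q : dual_sphere X) x : K^o)]
  `&` ~` (B `\ set_val p).
have oO : open O.
  apply: openI; first exact: open_abs_gt.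
  apply: closed_openC; apply: (accessible_finite_set_closed.1 (@sphere_quot_accessible _ _ X)).
  exact: finite_setD.
have Op : O (set_val p).
  split; last by case=> _; apply.
  rewrite /= (@sphere_proj_abs _ _ _ _ e); first by rewrite ex -(of_real1 R c) abs_of_real normr1; lra.
  by rewrite ep; exact: reprK.
have [q [qp _ [Oq Bq]]] : exists q : EX X, [/\ q != p, setT q & O (set_val q)].
  by apply: pE'; exists (set_val @^-1` O); split => //; exists O.
have [e' [a [e'q e'_ext e'a]]] := EX_atom q.
exists (set_val e'), a; split=> //.
  by move: Oq; rewrite /= (@sphere_proj_abs _ _ _ _ e') // e'q; exact: reprK.
move=> f ffs; rewrite leNgt; apply/negP => h; apply: Bq; split.
  by exists f => //; exists e', a; split=> //; exact: ltW.
by move=> /val_inj qpE; move/eqP: qp.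
Qed.

(** The scalar opposite to the phase of e' x is prescribed as the value of e' at y,
    so that |e' (x - y)| is close to |e' x| + 1. *)
Theorem diametral_peak (p : EX X) (e : dual_sphere X) x (V : set X) :
  unit_ball X x -> EX' X p -> sphere_proj X e = set_val p -> set_val e x = 1 ->
  rel_weakly_open V -> V x -> sup [set rnorm (x - y) | y in V] = 2.
Proof.
move=> xB pE' ep ex oV Vx; have VB y : V y -> unit_ball X y.
  by case: oV => [U _ ->] [].
have le2 y : V y -> rnorm (x - y) <= 2.
  move=> /VB yB; apply: le_trans (ler_rnormD _ _) _; rewrite rnormN (_ : 2 = 1 + 1) //.
  exact: lerD.
apply/eqP; rewrite eq_le; apply/andP; split.
  by apply: ge_sup => [|_ [y /le2 ? <-] //]; exists (rnorm (x - x)), x.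
apply/ler_addgt0Pr => d d0.
have [fs [r [dfs r0 fsV]]] := weak_nbhs_finite oV Vx.
have [r4 d2] : 0 < r / 4 /\ 0 < d / 2 by rewrite !divr_gt0.
have [e' [a [e'a e'x fsm]]] := exists_light_direction pE' ep ex dfs r4 d2.
have [de' _ _ _] := e'a; have [u u1 uE] := exists_phase (e' x).
have s1 : rnorm (- scalar_conj u : K^o) <= 1 by rewrite rnormN abs_conj u1.
have k0 : 0 < Num.min (r / 2) (d / 2) by rewrite lt_min !divr_gt0.
have [|y [yB ey fy]] := L_atom_patch (fs := fs) (m := r / 4) e'a xB s1 k0.
  by move=> f ffs; split; [exact: dfs|exact: fsm].
have Vy : V y.
  apply: fsV => // f ffs; apply: lt_le_trans (fy f ffs) _.
  have : Num.min (r / 2) (d / 2) <= r / 2 by rewrite ge_min lexx.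
  lra.
have : rnorm (x - y) <= sup [set rnorm (x - y) | y in V].
  by apply: sup_upper_bound; [split; [exists (rnorm (x - y)), y|exists 2 => _ [z /le2 ? <-]]|exists y].
have : rnorm (e' x - e' y : K^o) <= rnorm (x - y).
  rewrite -linear_funB; last by case: de'.
  by have := dual_normP (x - y) de'; rewrite (L_atom_norm e'a) mul1r.
have : rnorm (e' x + scalar_conj u : K^o) = rnorm (e' x : K^o) + 1.
  rewrite -[LHS]mul1r -u1 -absM mulrDr uE [u * _]mulrC mul_conj u1 expr1n -of_realD.
  by rewrite abs_of_real ger0_norm // addr_ge0 // rnorm_ge0.
have := rnorm_triangle (e' x : K^o) (e' y : K^o) (- scalar_conj u : K^o); rewrite opprK.
have : Num.min (r / 2) (d / 2) <= d / 2 by rewrite ge_min lexx orbT.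
move: ey; rewrite (@rnormB _ _ K^o) opprK.
move: (rnorm (e' y + _)) => n1; move: (rnorm (e' x + _)) => n2 *; lra.
Qed.

End Diametral.

Theorem corollary2p9 (R : realType) (c : scalar_kind)
    (X : completeNormedModType (scalar_field R c)) :
  L1_predual X -> infinite_set (EX' X) -> weak_DD2P X.
Proof.
move=> preX infE W oW W0; have [p [e [x [pE' ep Wx ex]]]] := exists_peak preX infE oW W0.
exists x => // V oV Vx; apply: (diametral_peak preX) pE' ep ex oV Vx.
by case: oW Wx => [U _ ->] [].
Qed.
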